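(* Let $h\in\Pi^n_{\mathbb{Q}}(\overline{X}_T)$. Suppose that $$|A|_{\mathbf{z},\mathbf{d},\mathbf{r},\mathbf{l}}(h)<\infty$$ for every combination of multi-indices $\mathbf{z},\mathbf{d},\mathbf{r},\mathbf{l}\in\{0,1\}^n$ with $|\mathbf{z}+\mathbf{d}+\mathbf{r}+\mathbf{l}|=n$ and $\|\mathbf{z}+\mathbf{d}+\mathbf{r}+\mathbf{l}\|=1$. Then the price $V^h=B_T^{-1}\mathbb{E}[h(\overline{X}_T)]$ of the European option with payoff $h(\overline{X}_T)$ is given by $$V^h=B_T^{-1}\sum_{\substack{|\mathbf{z}+\mathbf{d}+\mathbf{r}+\mathbf{l}|=n\\ \|\mathbf{z}+\mathbf{d}+\mathbf{r}+\mathbf{l}\|=1}}A_{\mathbf{z},\mathbf{d},\mathbf{r},\mathbf{l}}(h).$$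
   Context: Setting. $\mathbb{Q}$ is a probability measure (the pricing measure), $\mathbb{E}$ is expectation under $\mathbb{Q}$, $T>0$ is a fixed maturity, and $\overline{X}_T=(X_T^1,\ldots,X_T^n)$ is a random vector with $X_T^k\in L^1(\mathbb{Q})$ and $X_T^k\ge 0$ almost surely for every $k$. The bond $B_t$ is a deterministic non-decreasing function with $B_0=1$. Here $\mathbb{R}_+=[0,\infty)$. The price of a claim $C$ at time $0$ is $B_T^{-1}\mathbb{E}[C]$. Class $\Pi_{\mathbb{Q}}(X_T)$. For a non-negative random variable $X_T$, a function $f:\mathbb{R}_+\to\mathbb{R}$ belongs to $\Pi_{\mathbb{Q}}(X_T)$ if: (1) $f$ is continuously differentiable except on an at most countable set of points $0\le s_0<s_1<\cdots<s_\alpha<\cdots$ (indexed by the ordinals $\alpha<\gamma$ for some countable ordinal $\gamma$), at which $f$ and $f'$ have jump discontinuities; (2) $f(X_T)\in L^1(\mathbb{Q})$; (3) $\lim_{x\to\infty}|f(x-)|\,\mathbb{Q}(X_T\ge x)=0$; (4) the integral $\int_0^\infty f'(a)\,\mathbb{Q}(X_T>a)\,da$ is finite. Class $\Pi^n_{\mathbb{Q}}(\overline{X}_T)$. A function $h:\mathbb{R}_+^n\to\mathbb{R}$ belongs to $\Pi^n_{\mathbb{Q}}(\overline{X}_T)$ if: (1) $h(\overline{x})=\sum_{k=1}^m\prod_{j=1}^n f_{k,j}(x_j)$ with $f_{k,j}\in\Pi_{\mathbb{Q}}(X_T^j)$ for all $k=1,\ldots,m$, $j=1,\ldots,n$; (2)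 for every $k=1,\ldots,m$, every $i=1,\ldots,n$ and every permutation $\sigma$ of $\{1,\ldots,n\}$, $\prod_{j=1}^i f_{k,\sigma(j)}(X_T^{\sigma(j)})\in L^1(\mathbb{Q})$; (3) for every $k=1,\ldots,m$ and every $i=1,\ldots,n$, $\lim_{b\to\infty}|f_{k,i}(b-)|\,\mathbb{E}\big[\mathbf{1}_{X_T^i\ge b}\prod_{j=1}^{i-1}|f_{k,j}(X_T^j)|\big]=0$. Multi-indices. All multi-indices $\mathbf{a}$ are in $\{0,1\}^n$ and are identified with subsets of $\{1,\ldots,n\}$; $|\mathbf{a}|=a_1+\cdots+a_n$ and $\|\mathbf{a}\|=\max_i a_i$ (also for sums of multi-indices). Thus $|\mathbf{z}+\mathbf{d}+\mathbf{r}+\mathbf{l}|=n$, $\|\mathbf{z}+\mathbf{d}+\mathbf{r}+\mathbf{l}\|=1$ means that $\mathbf{z},\mathbf{d},\mathbf{r},\mathbf{l}$ partition $\{1,\ldots,n\}$. Operators. $\partial_k$ is the partial derivative in $x_k$ (defined off the exceptional points), and $\mathbf{0}_kh(\overline{x})=h(x_1,\ldots,x_{k-1},0,x_{k+1},\ldots,x_n)$. Let $\tilde\Delta_{+,k}h(\overline{x})=h(\ldots,x_k+,\ldots)-h(\overline{x})$ (right jump in the variable $x_k$) and $\tilde\Delta_{-,k}h(\overline{x})=h(\overline{x})-h(\ldots,x_k-,\ldots)$ (left jump in $x_k$), with $\tilde\Delta_{-,k}h(\overline{x})=0$ when $x_k=0$. For a multi-index $\mathbf{a}$, write $\mathbf{0}^{\mathbf{a}},\partial^{\mathbf{a}},\tilde\Delta_+^{\mathbf{a}},\tilde\Delta_-^{\mathbf{a}}$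 for the composition of the corresponding operators over $k\in\mathbf{a}$. Functionals. For $\mathbf{z},\mathbf{d},\mathbf{r},\mathbf{l}$ partitioning $\{1,\ldots,n\}$, $$A_{\mathbf{z},\mathbf{d},\mathbf{r},\mathbf{l}}(h)=\int_{\mathbb{R}_+^{|\mathbf{d}|}}\ \sum_{(y_\sigma)_{\sigma\in\mathbf{r}+\mathbf{l}}\in\mathbb{R}_+^{|\mathbf{r}+\mathbf{l}|}}\big(\tilde\Delta_+^{\mathbf{r}}\tilde\Delta_-^{\mathbf{l}}\mathbf{0}^{\mathbf{z}}\partial^{\mathbf{d}}h\big)(\overline{y})\ \mathbb{Q}\Big(\bigwedge_{\sigma\in\mathbf{d}+\mathbf{r}}(X_T^\sigma>y_\sigma)\ \wedge\ \bigwedge_{\sigma\in\mathbf{l}}(X_T^\sigma\ge y_\sigma)\Big)\prod_{\sigma\in\mathbf{d}}dy_\sigma ,$$ and $|A|_{\mathbf{z},\mathbf{d},\mathbf{r},\mathbf{l}}(h)$ is defined by the same formula with $\big(\tilde\Delta_+^{\mathbf{r}}\tilde\Delta_-^{\mathbf{l}}\mathbf{0}^{\mathbf{z}}\partial^{\mathbf{d}}h\big)(\overline{y})$ replaced by its absolute value. (Only countably many terms in the sum are non-zero. An empty integral or sum means evaluation, and the probability of an empty conjunction is $1$.) *)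

(* Defs.v *)
From HB Require Import structures.
From mathcomp Require Import all_boot all_order all_algebra.
From mathcomp Require Import all_classical all_reals all_analysis.
From mathcomp Require Import perm wochoice.
Set Implicit Arguments.
Unset Strict Implicit.
Unset Printing Implicit Defensive.
Import Order.TTheory GRing.Theory Num.Theory.
Import numFieldNormedType.Exports.
Local Open Scope classical_set_scope.
Local Open Scope ring_scope.

(* Functions on R_+ (resp. R_+^n) are represented by total functions on R
   (resp. 'rV[R]_n).  As the X^k are only almost surely non-negative,
   expectations of functions of the X^k are taken over the almost sure event
   on which the arguments lie in R_+; values at negative arguments play no
   role. *)

Section OneVariable.
Context {R : realType}.

Definition left_lim (f : R -> R) (x : R) : R := lim (f t @[t --> x^'-]).
Definition right_lim (f : R -> R) (x : R) : R := lim (f t @[t --> x^'+]).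

(* [f] is continuously differentiable on R_+ off the exceptional set [S], the
   derivative being regarded as a function on R_+ \ S only; at the end point 0
   the derivative is the right derivative. *)
Definition C1_off (S : set R) (f : R -> R) : Prop :=
  (forall x : R, 0 < x -> ~ S x ->
     derivable f x 1 /\
     f^`()%classic t @[t --> within (~` S) (nbhs x)] --> f^`()%classic x) /\
  (~ S 0 -> exists c : R,
     t^-1 * (f t - f 0) @[t --> 0^'+] --> c /\
     f^`()%classic t @[t --> within (~` S) 0^'+] --> c).

(* At the points of [S], f and f' have finite one-sided limits (only right
   limits at 0).  The jump of f, or of f', may vanish, as it does for f at the
   kink of a call payoff; the value f(s) is unconstrained. *)
Definition jumps_on (S : set R) (f : R -> R) : Prop :=
  forall s, S s ->
    [/\ cvg (f t @[t --> s^'+]),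
        cvg (f^`()%classic t @[t --> within (~` S) s^'+]) &
        0 < s -> cvg (f t @[t --> s^'-]) /\
                 cvg (f^`()%classic t @[t --> within (~` S) s^'-])].

(* A set of reals is the range of a strictly increasing family indexed by the
   ordinals below a countable ordinal iff it is countable and well-ordered
   by <=. *)
Definition piecewise_C1 (f : R -> R) : Prop :=
  exists S : set R,
    [/\ S `<=` [set x | 0 <= x], countable S,
        wo_chain (<=%R : rel R) [pred x | x \in S],
        C1_off S f & jumps_on S f].

End OneVariable.

Section Classes.
Context {d : measure_display} {T : measurableType d} {R : realType}.
Variable Q : probability T R.

Definition nonneg_event n (X : 'I_n -> T -> R) : set T :=
  [set w | forall k, 0 <= X k w].

Definition vec n (X : 'I_n -> T -> R) (w : T) : 'rV[R]_n := \row_k X k w.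

Definition Pi_class (X : T -> R) (f : R -> R) : Prop :=
  [/\ piecewise_C1 f,
      Q.-integrable [set w | 0 <= X w] (EFin \o (f \o X)),
      (`|left_lim f x|%:E * Q [set w | (x <= X w)%R])%E @[x --> +oo] --> 0%E &
      lebesgue_measure.-integrable `[0, +oo[
        (fun a => (f^`()%classic a)%:E * Q [set w | (a < X w)%R])%E].

Definition PiN_class n (X : 'I_n -> T -> R) (h : 'rV[R]_n -> R) : Prop :=
  exists (m : nat) (f : 'I_m -> 'I_n -> R -> R),
    [/\ forall x : 'rV[R]_n, (forall j, 0 <= x ord0 j) ->
          h x = \sum_(k < m) \prod_(j < n) f k j (x ord0 j),
        forall k j, Pi_class (X j) (f k j),
        forall k (i : 'I_n) (s : {perm 'I_n}),
          Q.-integrable (nonneg_event X)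
            (fun w => (\prod_(j < n | (j <= i)%N) f k (s j) (X (s j) w))%:E) &
        forall k (i : 'I_n),
          (`|left_lim (f k i) b|%:E *
           \int[Q]_(w in nonneg_event X `&` [set w | (b <= X i w)%R])
             (\prod_(j < n | (j < i)%N) `|f k j (X j w)|)%:E)%E
            @[b --> +oo] --> 0%E].

Definition price n (B_T : R) (X : 'I_n -> T -> R) (h : 'rV[R]_n -> R) : \bar R :=
  ((B_T^-1)%:E * 'E_Q[(fun w => h (vec X w)) \_ (nonneg_event X)])%E.

End Classes.

Section Operators.
Context {R : realType} {n : nat}.
Implicit Types (h : 'rV[R]_n -> R) (x : 'rV[R]_n) (k : 'I_n) (a : {set 'I_n}).

Definition upd x k (t : R) : 'rV[R]_n :=
  \row_j (if j == k then t else x ord0 j).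

Definition partial k h x : R := 'D_(delta_mx ord0 k) h x.
Definition at_zero k h x : R := h (upd x k 0).
Definition jump_r k h x : R :=
  right_lim (fun t => h (upd x k t)) (x ord0 k) - h x.
Definition jump_l k h x : R :=
  if x ord0 k == 0 then 0
  else h x - left_lim (fun t => h (upd x k t)) (x ord0 k).

Definition multi_op (op : 'I_n -> ('rV[R]_n -> R) -> 'rV[R]_n -> R) a h :
  'rV[R]_n -> R := foldr op h (enum a).

Definition mixed_op (z d r l : {set 'I_n}) h : 'rV[R]_n -> R :=
  multi_op jump_r r (multi_op jump_l l
    (multi_op at_zero z (multi_op partial d h))).

(* Integral over R_+^s with respect to the coordinates listed in [s], the other
   coordinates being read off from [x].  By Tonelli's theorem this is the
   integral for |s|-dimensional Lebesgue measure as soon as the integral of the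
   absolute value is finite. *)
Definition int_coords (s : seq 'I_n) (F : 'rV[R]_n -> \bar R) :
    'rV[R]_n -> \bar R :=
  foldr (fun k G x =>
    (\int[lebesgue_measure]_(t in `[0%R, +oo[) G (upd x k t))%E) F s.

(* Unordered sum of the values of [F] at the points obtained from [x] by
   letting the coordinates in [a] range over R_+. *)
Definition sum_coords a (F : 'rV[R]_n -> \bar R) x : \bar R :=
  let Y := [set y : 'rV[R]_n |
    forall j, (j \in a -> 0 <= y ord0 j) /\
              (j \notin a -> y ord0 j = x ord0 j)] in
  ((\esum_(y in Y) (F^\+ y)) - (\esum_(y in Y) (F^\- y)))%E.

(* |z+d+r+l| = n and ||z+d+r+l|| = 1 *)
Definition multiplicity (z d r l : {set 'I_n}) k : nat :=
  ((k \in z) + (k \in d) + (k \in r) + (k \in l))%N.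
Definition is_split (z d r l : {set 'I_n}) : bool :=
  (\sum_k multiplicity z d r l k == n)%N &&
  (\max_k multiplicity z d r l k == 1)%N.

End Operators.

Section Functionals.
Context {d : measure_display} {T : measurableType d} {R : realType} {n : nat}.
Variables (Q : probability T R) (X : 'I_n -> T -> R).
Implicit Types (z dd r l : {set 'I_n}) (h : 'rV[R]_n -> R) (y : 'rV[R]_n).

Definition tail_prob dd r l y : \bar R :=
  Q [set w | (forall s, s \in dd :|: r -> y ord0 s < X s w) /\
             (forall s, s \in l -> y ord0 s <= X s w)].

(* The base point 0 is immaterial: the coordinates in z are never used. *)
Definition A_gen dd r l (g : 'rV[R]_n -> R) : \bar R :=
  int_coords (enum dd)
    (sum_coords (r :|: l) (fun y => (g y)%:E * tail_prob dd r l y)%E) 0.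

Definition A_fun z dd r l h : \bar R :=
  A_gen dd r l (mixed_op z dd r l h).
Definition absA_fun z dd r l h : \bar R :=
  A_gen dd r l (fun y => `|mixed_op z dd r l h y|).

End Functionals.

(* Main.v *)
Require Import Defs.
From HB Require Import structures.
From mathcomp Require Import all_boot all_order all_algebra.
From mathcomp Require Import all_classical all_reals all_analysis.
From mathcomp Require Import perm ring lra.
Set Implicit Arguments.
Unset Strict Implicit.
Unset Printing Implicit Defensive.
Import Order.TTheory GRing.Theory Num.Theory.
Import numFieldNormedType.Exports.
Import measurable_realfun.
Local Open Scope classical_set_scope.
Local Open Scope ring_scope.

(* A coordinate [j] of the payoff contributes in one of four kinds: its value at 0,
   its derivative (Lebesgue measure), its right jumps or its left jumps (counting
   measure on the exceptional set [S j]).  For one variable,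
     f(u) = f(0) + \int_0^u f' + \sum_(t < u) (right jumps) + \sum_(t <= u) (left jumps)
   as soon as the integral and the sums converge absolutely: the set of [u] where
   this holds is closed under left limits, and extends across every interval free of
   points of [S]; since [S] is well ordered there is a next such interval.
   Expanding one coordinate after the other expresses h(X(w)) as the sum over all
   assignments of kinds of the integrals of the mixed differences of h over the box
   below X(w).  The summands of h = \sum_k \prod_j f_kj need not be separately
   expandable, only h is; so the induction on coordinates is carried out for
   all combinations \sum_k c_k \prod_j f_kj at once.  By Tonelli the hypothesis on |A|
   is the integrability of this expansion over Q, for almost every w and on average,
   and integrating over w turns the indicator of the box into the tail
   probability. *)

(** * Counting measure on a countable set of reals *)

(** The sums in [sum_coords] run over uncountably many points, and counting measure on the whole
    line is not sigma-finite, so Tonelli would not exchange it with [Q]. As the jumps vanish off the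
    countable set [S j], counting measure on [S j] takes its place; evaluation at 0 becomes
    integration against a Dirac mass. All four kinds are then sigma-finite integrals over [[0,
    +oo[], and coordinates can be reordered and exchanged with the expectation. Tonelli serves
    non-negative integrands only, so the iterated integrals are taken of [g (term w q)] with [g] the
    absolute value, the positive part or the negative part. The one-variable formula, however, is
    linear and sees only the difference of the last two. Inner integrals are known to be finite only
    almost everywhere, for Lebesgue, counting or Dirac measure as the kind dictates; hence the
    statements that carry the finiteness of both parts along with the value of their difference. *)

Section CountingMeasure.
Local Open Scope ereal_scope.
Context {R : realType}.
Variables (S : set R) (code : R -> nat).
Hypothesis code_inj : {in S &, injective code}.

Local Notation mT := (measurableTypeR R).

(** A series of point masses, one per code, is a measure by construction, and integrals against it
    are computed term by term; codes taken by no point of [S] get the zero measure. *)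
Definition atom (k : nat) : {measure set mT -> \bar R} :=
  match pselect (exists x, S x /\ code x = k) with
  | left e => \d_(projT1 (cid e) : mT)
  | right _ => mzero
  end.

Lemma integral_atom_code (D : set mT) (F : mT -> \bar R) x :
  measurable D -> measurable_fun D F -> S x ->
  \int[atom (code x)]_(t in D) F t = if x \in D then F x else 0.
Proof.
move=> mD mF Sx; rewrite /atom; case: pselect => [e|]; last by case; exists x.
case: cid => y /= [Sy yx]; have -> : y = x by apply: code_inj; rewrite ?inE.
by rewrite integral_dirac// diracE; case: (x \in D); rewrite ?mul1e ?mul0e.
Qed.

Lemma integral_atom_notin (D : set mT) (F : mT -> \bar R) k :
  measurable D -> measurable_fun D F -> ~ (exists x, S x /\ code x = k) ->
  \int[atom k]_(t in D) F t = 0.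
Proof.
by move=> mD mF nk; rewrite /atom; case: pselect => // _; rewrite integral_measure_zero.
Qed.

Definition counting_on : set mT -> \bar R := mseries atom 0%N.

HB.instance Definition _ := Measure.copy counting_on (mseries atom 0%N).

Lemma integral_counting_on (D : set mT) (F : mT -> \bar R) :
  measurable D -> measurable_fun D F -> (forall x, D x -> 0 <= F x) ->
  \int[counting_on]_(t in D) F t = \esum_(t in S `&` D) F t.
Proof.
move=> mD mF F0; rewrite (ge0_integral_measure_series _ mD)//.
have I0 k : 0 <= \int[atom k]_(x in D) F x by exact: integral_ge0.
rewrite nneseries_esumT//.
pose Q := code @` (S `&` D).
transitivity (\esum_(k in Q) \int[atom k]_(x in D) F x).
  rewrite [RHS]esum_mkcond; apply: eq_esum => k _.
  case: ifPn => // /negP kQ.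
  have [[x [Sx xk]]|nk] := pselect (exists x, S x /\ code x = k).
    rewrite -xk integral_atom_code//; case: ifPn => // /set_mem Dx.
    by exfalso; apply: kQ; rewrite inE; exists x.
  by rewrite integral_atom_notin.
rewrite (reindex_esum (S `&` D) Q code).
  by apply: eq_esum => x [Sx Dx]; rewrite integral_atom_code// mem_set.
split => [x Sx|x y|//]; first by exists x.
by rewrite !inE => -[Sx _] [Sy _]; apply: code_inj; rewrite inE.
Qed.

(** Each exhausting set contains the whole complement of [S], which has mass 0, and the finitely
    many points of [S] with code below [n]. *)
Lemma sigma_finite_counting_on : sigma_finite setT counting_on.
Proof.
have cS : countable S by apply/countable_injP; exists code.
pose B n := [set x | S x /\ (code x < n)%N].
have fB n : finite_set (B n).
  have injB : {in B n &, injective code}.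
    by move=> x y /set_mem[Sx _] /set_mem[Sy _]; apply: code_inj; rewrite inE.
  rewrite -(eq_finite_set (inj_card_eq injB)).
  by apply: sub_finite_set (finite_II n) => _ [x [_ xn] <-].
exists (fun n => ~` S `|` B n).
  apply/esym; rewrite -subTset => x _.
  have [Sx|nSx] := pselect (S x); last by exists 0%N => //; left.
  by exists (code x).+1 => //; right; split => /=.
move=> n; have mB : measurable (~` S `|` B n : set mT).
  apply: measurableU; first by apply: measurableC; exact: countable_measurable.
  by apply: countable_measurable => //; exact: finite_set_countable.
split => //.
have <- : \int[counting_on]_(t in ~` S `|` B n) (cst 1 t) = counting_on (~` S `|` B n).
  by rewrite integral_cst// mul1e.
rewrite integral_counting_on//.
have -> : S `&` (~` S `|` B n) = B n.
  by apply/seteqP; split => x; [case=> Sx [//|] | move=> [Sx xn]; split => //; right].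
rewrite esum_fset// fsbig_finite//=.
by rewrite sumEFin ltry.
Qed.

End CountingMeasure.

Lemma exists_counting_measure {R : realType} (S : set R) : countable S ->
  exists mu : {sigma_finite_measure set (measurableTypeR R) -> \bar R},
    forall (D : set R) (F : R -> \bar R),
      measurable (D : set (measurableTypeR R)) ->
      measurable_fun (D : set (measurableTypeR R)) F ->
      (forall x, D x -> 0 <= F x)%E ->
      (\int[mu]_(t in D) F t = \esum_(t in S `&` D) F t)%E.
Proof.
move=> /countable_injP[code code_inj].
pose mu : {sigma_finite_measure set (measurableTypeR R) -> \bar R} :=
  HB.pack (counting_on S code)
    (Measure_isSigmaFinite.Build _ _ _ _ (sigma_finite_counting_on code_inj)).
by exists mu; exact: integral_counting_on.
Qed.

(** * The four kinds of increments of a function of one variable *)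

(** Dominated convergence for the restrictions of [g] to the sets [D n], dominated by [|g|]. *)
Lemma cvg_Rintegral_bigcup d (T : measurableType d) (R : realType)
    (mu : {measure set T -> \bar R}) (D : (set T)^nat) (g : T -> R) :
  (forall n, measurable (D n)) ->
  {homo D : m n / (m <= n)%N >-> m `<=` n} ->
  mu.-integrable (\bigcup_n D n) (EFin \o g) ->
  \int[mu]_(x in D n) g x @[n --> \oo] --> \int[mu]_(x in \bigcup_n D n) g x.
Proof.
move=> mD ndD ig; set E := \bigcup_n D n.
have mE : measurable E by exact: bigcup_measurable.
have mg : measurable_fun E (EFin \o g) by exact: measurable_int ig.
have DE n : E `&` D n = D n by apply: setIidr; exact: bigcup_sup.
have [] := @dominated_convergence _ _ _ mu E mE (fun n => (EFin \o g) \_ (D n))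
  (EFin \o g) (abse \o (EFin \o g)).
- by move=> n; apply/measurable_restrict => //; apply: measurable_funS mg.
- exact: mg.
- apply: aeW => x [N _ DNx]; apply: cvg_near_cst; exists N => // n /= Nn.
  by rewrite patchE mem_set//; exact: ndD DNx.
- exact: integrable_abse.
- apply: aeW => x n _; rewrite /= patchE; case: ifPn => //= _.
  by rewrite normr0 lee_fin.
move=> _ _ /=.
under [X in X @ _ --> _]eq_fun do rewrite -integral_mkcondr DE.
move=> cvD; apply: fine_cvg; rewrite fineK//; exact: integrable_fin_num.
Qed.

Inductive kind := Kz | Kd | Kr | Kl.

Definition nat_of_kind a : nat :=
  match a with Kz => 0 | Kd => 1 | Kr => 2 | Kl => 3 end.
Definition kind_of_nat k : kind :=
  match k with 0%N => Kz | 1%N => Kd | 2%N => Kr | _ => Kl end.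
Lemma nat_of_kindK : cancel nat_of_kind kind_of_nat. Proof. by case. Qed.
HB.instance Definition _ := Equality.copy kind (can_type nat_of_kindK).
HB.instance Definition _ := Choice.copy kind (can_type nat_of_kindK).
HB.instance Definition _ := Countable.copy kind (can_type nat_of_kindK).
Lemma kind_enumP : Finite.axiom [:: Kz; Kd; Kr; Kl]. Proof. by case. Qed.
HB.instance Definition _ := fintype.isFinite.Build kind kind_enumP.

Lemma big_kind (T : Type) (idx : T) (op : Monoid.com_law idx) (F : kind -> T) :
  \big[op/idx]_a F a = op (F Kz) (op (F Kd) (op (F Kr) (F Kl))).
Proof.
have e : enum {: kind} = [:: Kz; Kd; Kr; Kl] by rewrite enumT unlock.
by rewrite -big_enum e !big_cons big_nil Monoid.mulm1.
Qed.

Section OneVariableFormula.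
Context {R : realType}.
Implicit Types (S : set R) (f : R -> R) (a : kind) (t u : R).
Local Notation mT := (measurableTypeR R).

(* The density, for the measure [kind_measure], of the contribution of kind [a].  It
   is set to 0 where that measure does not see it, so that it is always measurable. *)
Definition part S f a t : R :=
  match a with
  | Kz => f 0
  | Kd => if (t \in S) || (t <= 0) then 0 else f^`()%classic t
  | Kr => if t \in S then right_lim f t - f t else 0
  | Kl => if (t \in S) && (0 < t) then f t - left_lim f t else 0
  end.

(** A right jump at [t] is felt only by arguments beyond [t], a left jump already at [t] itself;
    this is the origin of the strict and weak inequalities in the tail probability. *)
Definition reach a t u : bool :=
  match a with Kz => true | Kd | Kr => t < u | Kl => t <= u end.

Definition kind_measure (muS : {sigma_finite_measure set mT -> \bar R}) a :
    {sigma_finite_measure set mT -> \bar R} :=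
  match a with Kz => \d_(0 : mT) | Kd => lebesgue_measure | _ => muS end.

(* The part of [piecewise_C1] that is stable under linear combinations for a fixed [S]
   and under enlarging [S]; the one-sided limits of f' on [S] are not needed. *)
Definition regular_off S f : Prop :=
  [/\ forall x, 0 < x -> ~ S x -> derivable f x 1 /\
        f^`()%classic t @[t --> within (~` S) (nbhs x)] --> f^`()%classic x,
      forall x, 0 <= x -> cvg (f t @[t --> x^'+]),
      ~ S 0 -> f t @[t --> 0^'+] --> f 0 &
      forall x, 0 < x -> cvg (f t @[t --> x^'-])].

(** The preimage of [B] is co-countable if [B] contains 0, and countable otherwise. *)
Lemma measurable_fun_countable_support S (f : mT -> R) :
  countable S -> (forall x, ~ S x -> f x = 0) -> measurable_fun setT f.
Proof.
move=> cS f0 _ B mB; rewrite setTI.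
have mc (A : set mT) : countable A -> measurable A.
  by apply: countable_measurable.
have [B0|B0] := pselect (B 0).
  rewrite -[_ @^-1` _]setCK; apply: measurableC; apply: mc.
  apply: sub_countable cS; apply: subset_card_le => x /= nBx.
  by apply: contrapT => /f0 fx; apply: nBx; rewrite fx.
apply: mc; apply: sub_countable cS; apply: subset_card_le => x /= Bx.
by apply: contrapT => /f0 fx; apply: B0; rewrite -fx.
Qed.

Lemma measurable_derive1_off S f : countable S -> regular_off S f ->
  measurable_fun (`]0, +oo[ `\` S : set mT) (f^`()%classic : mT -> R).
Proof.
move=> cS [f1 _ _ _].
have mD : measurable (`]0, +oo[ `\` S : set mT).
  by apply: measurableD => //; exact: countable_measurable.
apply: subspace_continuous_measurable_fun => //.
apply/subspace_continuousP => x [/=]; rewrite in_itv/= andbT => x0 nSx.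
have [_ cx] := f1 _ x0 nSx.
apply: cvg_trans cx; apply: cvg_app.
by apply: within_subset => y [].
Qed.

Lemma measurable_part S f a : countable S -> regular_off S f ->
  measurable_fun setT (part S f a : mT -> R).
Proof.
move=> cS rf; case: a => /=.
- exact: measurable_cst.
- have mD : measurable (`]0, +oo[ `\` S : set mT).
    by apply: measurableD => //; exact: countable_measurable.
  rewrite (_ : part S f Kd = (f^`()%classic \_ (`]0, +oo[ `\` S))).
    apply/(measurable_restrict _ mD measurableT); rewrite setTI.
    exact: measurable_derive1_off.
  apply/funext => t; rewrite patchE in_setD /part; case: (boolP (t \in S)) => tS /=.
    by rewrite andbF.
  by rewrite andbT mem_setE in_itv/= andbT ltNge; case: (t <= 0).
- apply: (measurable_fun_countable_support cS) => x nSx.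
  by rewrite /part memNset.
- apply: (measurable_fun_countable_support cS) => x nSx.
  by rewrite /part memNset.
Qed.

End OneVariableFormula.

(** * The one-variable formula *)

Section OneVariableTheorem.
Context {R : realType}.
Local Notation mT := (measurableTypeR R).
Variables (S : set R) (f : R -> R).
Variable muS : {sigma_finite_measure set mT -> \bar R}.
Hypothesis S_min : forall A, A `<=` S -> A !=set0 ->
  exists2 m, A m & forall y, A y -> m <= y.
Hypothesis f_regular : regular_off S f.
Hypothesis muSE : forall (D : set mT) (F : mT -> \bar R),
  measurable D -> measurable_fun D F -> (forall x, D x -> 0 <= F x)%E ->
  (\int[muS]_(t in D) F t = \esum_(t in S `&` D) F t)%E.

Lemma muS_set1 q : S q -> muS ([set q] : set mT) = 1%E.
Proof.
move=> Sq; rewrite -[LHS]mul1e -integral_cst// muSE//.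
by rewrite setIC (_ : _ `&` _ = [set q]) ?esum_set1//; apply/seteqP;
  split => [x []//|x /= ->].
Qed.

Lemma Rintegral_muS_set1 (g : R -> R) q : (forall x, ~ S x -> g x = 0) ->
  \int[muS]_(t in [set q]) g t = g q.
Proof.
move=> g0; transitivity (\int[muS]_(t in [set q]) (g q)).
  by apply: eq_Rintegral => x; rewrite inE => ->.
rewrite Rintegral_cst//; have [Sq|nSq] := pselect (S q).
  by rewrite [X in fine X](muS_set1 Sq) mulr1.
by rewrite g0// mul0r.
Qed.

Lemma Rintegral_muS_off (g : R -> R) (D : set R) : (forall x, ~ S x -> g x = 0) ->
  D `&` S = set0 -> \int[muS]_(t in D) g t = 0.
Proof.
move=> g0 DS; rewrite /Rintegral integral0_eq// => x Dx.
by rewrite g0// => Sx; have : set0 x by rewrite -DS.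
Qed.

Lemma part_r_off x : ~ S x -> part S f Kr x = 0.
Proof. by move=> nSx; rewrite /part memNset. Qed.

Lemma part_l_off x : ~ S x -> part S f Kl x = 0.
Proof. by move=> nSx; rewrite /part memNset. Qed.

Lemma continuous_off x : 0 < x -> ~ S x -> {for x, continuous f}.
Proof.
move=> x0 nSx; have [f1 _ _ _] := f_regular; have [fx _] := f1 x x0 nSx.
by apply: differentiable_continuous; apply/derivable1_diffP.
Qed.

(** Off [S] both sides vanish, because [f] is continuous there; later steps thus need no case
    distinction on [S]. *)
Lemma part_lE x : 0 < x -> part S f Kl x = f x - left_lim f x.
Proof.
move=> x0; rewrite /part x0 andbT; case: ifPn => // /negP nS.
have nSx : ~ S x by move=> /mem_set.
rewrite /left_lim (cvg_lim _ (cvg_at_left_filter (continuous_off x0 nSx)))//.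
by rewrite subrr.
Qed.

(** As for left jumps, except that at 0, when 0 is not in [S], right continuity comes from the third
    clause of [regular_off]. *)
Lemma part_rE x : 0 <= x -> part S f Kr x = right_lim f x - f x.
Proof.
move=> x0; rewrite /part; case: ifPn => // /negP nS.
have nSx : ~ S x by move=> /mem_set.
have fx : f t @[t --> x^'+] --> f x.
  move: x0; rewrite le_eqVlt => /predU1P[x0|x0].
    by have [_ _ f0 _] := f_regular; rewrite -x0; apply: f0; rewrite x0.
  exact: cvg_at_right_filter (continuous_off x0 nSx).
by rewrite /right_lim (cvg_lim _ fx)// subrr.
Qed.

(** Starting at 1/2 keeps [r n] strictly between 0 and 1 also for [n = 0], so that [lseq] and [rseq]
    stay strictly inside the interval. *)
Let r (n : nat) : R := n.+2%:R^-1.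

Let r_gt0 n : 0 < r n. Proof. by rewrite invr_gt0. Qed.
Let r_lt1 n : r n < 1. Proof. by rewrite invf_lt1// ltr1n. Qed.
Let r_dec m n : (m <= n)%N -> r n <= r m.
Proof. by move=> mn; rewrite lef_pV2 ?posrE// ler_nat !ltnS. Qed.
Let r_cvg : r n @[n --> \oo] --> (0 : R).
Proof. by have h := @cvg_harmonic R; rewrite -cvg_shiftS in h. Qed.

Let lseq (a b : R) n := b - (b - a) * r n.
Let rseq (a b : R) n := a + (b - a) * r n.

Let lseq_itv a b n : a < b -> a < lseq a b n < b.
Proof.
move=> ab; have := r_gt0 n; have := r_lt1 n; rewrite /lseq.
by move: (r n) => z z1 z0; apply/andP; split; nra.
Qed.

Let rseq_itv a b n : a < b -> a < rseq a b n < b.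
Proof.
move=> ab; have := r_gt0 n; have := r_lt1 n; rewrite /rseq.
by move: (r n) => z z1 z0; apply/andP; split; nra.
Qed.

Let lseq_inc a b m n : a < b -> (m <= n)%N -> lseq a b m <= lseq a b n.
Proof. by move=> ab /r_dec; rewrite /lseq; move: (r m) (r n) => x y; nra. Qed.

Let rseq_dec a b m n : a < b -> (m <= n)%N -> rseq a b n <= rseq a b m.
Proof. by move=> ab /r_dec; rewrite /rseq; move: (r m) (r n) => x y; nra. Qed.

Let lseq_cvg a b : lseq a b n @[n --> \oo] --> b.
Proof.
rewrite -[X in _ --> X]subr0 -(mulr0 (b - a)); apply: cvgB; first exact: cvg_cst.
by apply: cvgM; [exact: cvg_cst|exact: r_cvg].
Qed.

Let rseq_cvg a b : rseq a b n @[n --> \oo] --> a.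
Proof.
rewrite -[X in _ --> X]addr0 -(mulr0 (b - a)); apply: cvgD; first exact: cvg_cst.
by apply: cvgM; [exact: cvg_cst|exact: r_cvg].
Qed.

(** Both kinds of right end point occur, since [N] integrates left jumps over closed intervals and
    the rest over half-open ones; in the limit the difference disappears. *)
Let bigcup_lseq (c a b : R) (s : bool) : a < b ->
  \bigcup_n [set` Interval (BLeft c) (BSide s (lseq a b n))] = `[c, b[%classic.
Proof.
move=> ab; apply/seteqP; split => x.
  case=> n _ /=; have /andP[_ lb] := lseq_itv n ab; rewrite !in_itv /=.
  by move=> /andP[-> /=]; case: s => /= h; [exact: lt_trans lb|exact: le_lt_trans lb].
rewrite /= in_itv/= => /andP[cx xb].
have [n _ /(_ n (leqnn n)) xn] := (cvgr_gt _ (@lseq_cvg a b) _ xb).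
by exists n => //=; rewrite in_itv/= cx/=; case: s => //; exact: ltW.
Qed.

Let bigcup_rseq (c a b : R) : a < b ->
  \bigcup_n `[rseq a b n, c]%classic = `]a, c]%classic.
Proof.
move=> ab; apply/seteqP; split => x.
  case=> n _ /=; have /andP[lb _] := rseq_itv n ab; rewrite !in_itv /=.
  by move=> /andP[h ->]; rewrite andbT; exact: lt_le_trans h.
rewrite /= in_itv/= => /andP[ax xc].
have [n _ /(_ n (leqnn n)) xn] := (cvgr_lt _ (@rseq_cvg a b) _ ax).
by exists n => //=; rewrite in_itv/= xc andbT; exact: ltW.
Qed.

Variable u : R.
Hypothesis u_ge0 : 0 <= u.
Hypothesis int_d : lebesgue_measure.-integrable (`[0, u[ :
  set mT) (EFin \o part S f Kd).
Hypothesis int_r : muS.-integrable (`[0, u[ : set mT) (EFin \o part S f Kr).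
Hypothesis int_l : muS.-integrable (`[0, u] : set mT) (EFin \o part S f Kl).

(** The domains of integration encode [reach]: [[0, x[] for a strict inequality, [[0, x]] for left
    jumps. *)
Let N x := f 0 + \int[lebesgue_measure]_(t in `[0, x[) part S f Kd t
  + \int[muS]_(t in `[0, x[) part S f Kr t + \int[muS]_(t in `[0, x]) part S f Kl t.

Let N0 : N 0 = f 0.
Proof.
rewrite /N !set_itvE !Rintegral_set0.
rewrite Rintegral_muS_set1; last exact: part_l_off.
by rewrite /part ltxx andbF !addr0.
Qed.

(** Letting arguments increase to [x], the right-hand sides converge to [N x] without the left jump
    at [x], and the values of [f] to its left limit. Adding the left jump on both sides gives the
    formula at [x]. *)
Let left_step x : 0 < x -> x <= u -> (forall y, 0 <= y -> y < x -> f y = N y) ->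
  f x = N x.
Proof.
move=> x0 xu fN; have [_ _ _ fl] := f_regular.
have fcv : f (lseq 0 x n) @[n --> \oo] --> left_lim f x.
  have /cvg_at_leftP := fl x x0; apply; split; last exact: lseq_cvg.
  by move=> n; have /andP[] := lseq_itv n x0.
have sub (b : bool) :
    [set` Interval (BLeft 0) (BSide b x)] `<=` [set` Interval (BLeft 0) (BSide b u)].
  by apply: subset_itvl; rewrite bnd_simp.
have Il : muS.-integrable (`[0, x[ : set mT) (EFin \o part S f Kl).
  by apply: integrableS int_l => //; apply: subset_itvl; rewrite bnd_simp.
have Id : lebesgue_measure.-integrable (`[0, x[ : set mT) (EFin \o part S f Kd).
  by apply: integrableS int_d => //; exact: sub.
have Ir : muS.-integrable (`[0, x[ : set mT) (EFin \o part S f Kr).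
  by apply: integrableS int_r => //; exact: sub.
have cvI (mu : {measure set mT -> \bar R}) (b : bool) (g : mT -> R) :
    mu.-integrable (`[0, x[ : set mT) (EFin \o g) ->
    \int[mu]_(t in [set` Interval (BLeft 0) (BSide b (lseq 0 x n))]) g t @[n --> \oo]
      --> \int[mu]_(t in `[0, x[) g t.
  move=> ig; rewrite -(bigcup_lseq 0 b x0); apply: cvg_Rintegral_bigcup => //.
  - move=> m n mn; apply: subset_itvl; have := lseq_inc x0 mn.
    by case: b; rewrite bnd_simp.
  - by rewrite bigcup_lseq.
have Ncv : N (lseq 0 x n) @[n --> \oo] -->
    f 0 + \int[lebesgue_measure]_(t in `[0, x[) part S f Kd t
    + \int[muS]_(t in `[0, x[) part S f Kr t + \int[muS]_(t in `[0, x[) part S f Kl t.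
  apply: cvgD; last exact: (cvI muS false _ Il).
  apply: cvgD; last exact: (cvI muS true _ Ir).
  exact: (cvgD (cvg_cst _) (cvI _ true _ Id)).
have llE : left_lim f x = f 0 + \int[lebesgue_measure]_(t in `[0, x[) part S f Kd t
    + \int[muS]_(t in `[0, x[) part S f Kr t + \int[muS]_(t in `[0, x[) part S f Kl t.
  have fNl : (fun n => f (lseq 0 x n)) = (fun n => N (lseq 0 x n)).
    by apply/funext => n; have /andP[h1 h2] := lseq_itv n x0; rewrite fN// ltW.
  by rewrite -(cvg_lim (@Rhausdorff R) fcv) fNl (cvg_lim (@Rhausdorff R) Ncv).
have Ixx : \int[muS]_(t in `[0, x]) part S f Kl t =
    \int[muS]_(t in `[0, x[) part S f Kl t + part S f Kl x.
  have e : `[0, x]%classic = `[0, x[%classic `|` [set x].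
    by rewrite setUitv1// bnd_simp ltW.
  rewrite e Rintegral_setU//.
  - by rewrite Rintegral_muS_set1//; exact: part_l_off.
  - by rewrite -e; apply: integrableS int_l => //; apply: subset_itvl.
  - by rewrite disj_set2E; apply/eqP/seteqP; split => [y|//]; case=> /[swap] /= ->;
      rewrite in_itv/= ltxx andbF.
by rewrite /N Ixx part_lE// addrA -llE addrC subrK.
Qed.

(** The left end must be positive, as [f] is known to be differentiable only at positive points off
    [S]; [right_step] reaches the end point [p] by a limit. *)
Let FTC_off a b : 0 < a -> a < b -> b <= u -> `[a, b] `&` S = set0 ->
  \int[lebesgue_measure]_(t in `[a, b]) part S f Kd t = f b - f a.
Proof.
move=> a0 ab bu abS; have [f1 _ _ _] := f_regular.
have nS x : x \in `[a, b] -> ~ S x.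
  by move=> xab Sx; have : set0 x by rewrite -abS.
have pos x : x \in `[a, b] -> 0 < x.
  by rewrite in_itv/= => /andP[ax _]; exact: lt_le_trans ax.
have dE x : x \in `[a, b] -> part S f Kd x = f^`()%classic x.
  by move=> xab; rewrite /part memNset/= ?leNgt ?pos//; exact: nS.
have cf x : x \in `[a, b] -> {for x, continuous f}.
  by move=> xab; apply: continuous_off; [exact: pos|exact: nS].
have -> : \int[lebesgue_measure]_(t in `[a, b]) part S f Kd t =
    \int[lebesgue_measure]_(t in `[a, b]) f^`()%classic t.
  by apply: eq_Rintegral => x /set_mem xab; rewrite dE.
rewrite /Rintegral.
rewrite (@continuous_FTC2 _ _ f _ _ ab).
- by [].
- apply/subspace_continuousP => x xab.
  have [_ cx] := f1 x (pos _ xab) (nS _ xab).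
  apply: cvg_trans cx; apply: cvg_app.
  by apply: within_subset => y yab; exact: nS.
- split.
  + by move=> x xab; have := subset_itv_oo_cc xab => xab';
      have [] := f1 x (pos _ xab') (nS _ xab').
  + by apply: cvg_at_right_filter; apply: cf; rewrite in_itv/= lexx ltW.
  + by apply: cvg_at_left_filter; apply: cf; rewrite in_itv/= lexx ltW.
- by [].
Qed.

(** No point of [S] lies strictly between [p] and [x], so [N] grows only by the right jump at [p]
    and the integral of [f']. The latter is [f x] minus the right limit at [p], by the fundamental
    theorem on [[rseq p x n, x]] and a limit in [n]; [p] itself may be exceptional. *)
Let right_step p q : 0 <= p -> p < q -> q <= u -> `]p, q[ `&` S = set0 ->
  f p = N p -> forall x, p < x -> x < q -> f x = N x.
Proof.
move=> p0 pq qu pqS fpN x px xq; have [_ fr _ _] := f_regular.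
have fcv : f (rseq p x n) @[n --> \oo] --> right_lim f p.
  have /cvg_at_rightP := fr p p0; apply; split; last exact: rseq_cvg.
  by move=> n; have /andP[] := rseq_itv n px.
have x0 : 0 < x by exact: le_lt_trans px.
have xu : x <= u by rewrite (le_trans _ qu)// ltW.
have Id : lebesgue_measure.-integrable (`[0, x[ : set mT) (EFin \o part S f Kd).
  by apply: integrableS int_d => //; apply: subset_itvl; rewrite bnd_simp.
have Ir : muS.-integrable (`[0, x[ : set mT) (EFin \o part S f Kr).
  by apply: integrableS int_r => //; apply: subset_itvl; rewrite bnd_simp.
have Il : muS.-integrable (`[0, x] : set mT) (EFin \o part S f Kl).
  by apply: integrableS int_l => //; apply: subset_itvl; rewrite bnd_simp.
have Id' : lebesgue_measure.-integrable (`]p, x] : set mT) (EFin \o part S f Kd).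
  apply: integrableS int_d => // y; rewrite /= !in_itv/= => /andP[py yx].
  by rewrite (ltW (le_lt_trans p0 py)) (le_lt_trans yx)// (lt_le_trans xq).
have FTC : f x - right_lim f p = \int[lebesgue_measure]_(t in `]p, x]) part S f Kd t.
  have h1 : f x - f (rseq p x n) @[n --> \oo] --> f x - right_lim f p.
    by apply: cvgB fcv; exact: cvg_cst.
  have h2 : \int[lebesgue_measure]_(t in `[rseq p x n, x]) part S f Kd t
     @[n --> \oo] --> \int[lebesgue_measure]_(t in `]p, x]) part S f Kd t.
    rewrite -(bigcup_rseq x px); apply: cvg_Rintegral_bigcup => //.
    - move=> m n mn; apply: subset_itvr; have := rseq_dec px mn.
      by rewrite bnd_simp.
    - by rewrite bigcup_rseq.
  rewrite -(cvg_lim (@Rhausdorff R) h1) -(cvg_lim (@Rhausdorff R) h2).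
  congr (lim (_ @ \oo)); apply/funext => n; have /andP[h3 h4] := rseq_itv n px.
  rewrite FTC_off//; first exact: le_lt_trans h3.
  apply: subsetI_eq0 pqS => // y; rewrite /= !in_itv/= => /andP[h5 h6].
  by rewrite (lt_le_trans h3)//= (le_lt_trans h6).
have NB : N x - N p = \int[lebesgue_measure]_(t in `]p, x]) part S f Kd t
    + part S f Kr p.
  have Edd : \int[lebesgue_measure]_(t in `[0, x[) part S f Kd t =
      \int[lebesgue_measure]_(t in `[0, p[) part S f Kd t
      + \int[lebesgue_measure]_(t in `]p, x]) part S f Kd t.
    have h : `[0, p[ `<=` `[0, x[ by apply: subset_itvl; rewrite bnd_simp ltW.
    have h' : `]p, x[ `<=` `]p, x] by apply: subset_itvl; rewrite bnd_simp.
    rewrite -(@Rintegral_itv_bndo_bndc _ (BRight p) x); last by apply: integrableS Id'.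
    rewrite (@Rintegral_itv_bndo_bndc _ (BLeft 0) p); last by apply: integrableS Id.
    by rewrite -(Rintegral_itvB Id) ?bnd_simp// addrC subrK.
  have xqS y : p < y -> y <= x -> ~ S y.
    move=> py yx Sy; have : set0 y by rewrite -pqS; split => //=;
      rewrite in_itv/= py (le_lt_trans yx).
    by [].
  (* The point [p] lies in [[0, x[] but not in [[0, p[], which brings in its right jump; its left
     jump is already counted in [N p]. *)
  have Err : \int[muS]_(t in `[0, x[) part S f Kr t =
      \int[muS]_(t in `[0, p[) part S f Kr t + part S f Kr p.
    have e : `[0, x[%classic = `[0, p]%classic `|` `]p, x[%classic.
      by rewrite -itv_bndbnd_setU// bnd_simp// ltW.
    have e' : `[0, p]%classic = `[0, p[%classic `|` [set p].
      by rewrite setUitv1// bnd_simp.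
    rewrite e Rintegral_setU//; last 2 first.
    - by rewrite -e.
    - by rewrite disj_set2E; apply/eqP/seteqP; split => [y|//]; case=> /=;
        rewrite !in_itv/= => /andP[_ yp] /andP[]; rewrite ltNge yp.
    rewrite [X in _ + X](Rintegral_muS_off part_r_off); last first.
      apply/seteqP; split => // y [/=]; rewrite in_itv/= => /andP[py yx].
      by apply: xqS => //; exact: ltW.
    rewrite addr0 e' Rintegral_setU//.
    - by rewrite Rintegral_muS_set1//; exact: part_r_off.
    - by rewrite -e'; apply: integrableS Ir => //; apply: subset_itvl; rewrite bnd_simp.
    - by rewrite disj_set2E; apply/eqP/seteqP; split => [y|//]; case=> /[swap] /= ->;
        rewrite in_itv/= ltxx andbF.
  have Ell : \int[muS]_(t in `[0, x]) part S f Kl t =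
      \int[muS]_(t in `[0, p]) part S f Kl t.
    have e : `[0, x]%classic = `[0, p]%classic `|` `]p, x]%classic.
      by rewrite -itv_bndbnd_setU// bnd_simp// ltW.
    rewrite e Rintegral_setU//; last 2 first.
    - by rewrite -e.
    - by rewrite disj_set2E; apply/eqP/seteqP; split => [y|//]; case=> /=;
        rewrite !in_itv/= => /andP[_ yp] /andP[]; rewrite ltNge yp.
    rewrite [X in _ + X](Rintegral_muS_off part_l_off) ?addr0//.
    apply/seteqP; split => // y [/=]; rewrite in_itv/= => /andP[py yx].
    exact: xqS.
  by rewrite /N Edd Err Ell; ring.
move: NB; rewrite -FTC part_rE// -fpN => /eqP.
by rewrite addrA subrK subr_eq subrK => /eqP.
Qed.

Lemma regular_formula_on : f u =
  f 0 + \int[lebesgue_measure]_(t in `[0, u[) part S f Kd t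
  + \int[muS]_(t in `[0, u[) part S f Kr t + \int[muS]_(t in `[0, u]) part S f Kl t.
Proof.
pose E := [set y | 0 <= y /\ y <= u /\ f y <> N y].
rewrite -/(N u); have [//|fu] := eqVneq (f u) (N u).
have Eu : E u by split => //; split => //; exact/eqP.
have lbE : lbound E 0 by move=> y [].
have iE : has_inf E by split; [exists u|exists 0].
pose i := inf E.
have i0 : 0 <= i by apply: lb_le_inf => //; exists u.
have iu : i <= u by apply: ge_inf => //; exists 0.
have good y : 0 <= y -> y < i -> f y = N y.
  move=> y0 yi; apply: contrapT => fy; move: (yi); rewrite ltNge => /negP; apply.
  apply: ge_inf; first by exists 0.
  by split => //; split => //; exact: ltW (lt_le_trans yi iu).
have gi : f i = N i.
  move: i0; rewrite le_eqVlt => /predU1P[<-|i0]; first by rewrite N0.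
  exact: left_step.
have goodi y : 0 <= y -> y <= i -> f y = N y.
  by move=> y0; rewrite le_eqVlt => /predU1P[->//|]; exact: good.
have iltu : i < u.
  by rewrite lt_neqAle iu andbT; apply/eqP => iu'; move: fu; rewrite -iu' gi eqxx.
(* Well-ordering enters here: [q] is the least point of [S] in []i, u]], or [u] if there is none. *)
have [q [iq qu qS]] : exists q, [/\ i < q, q <= u & `]i, q[ `&` S = set0].
  have [A0|] := pselect ((S `&` `]i, u]) !=set0).
    have [m [Sm /=]] := S_min (@subIsetl _ _ _) A0.
    rewrite in_itv/= => /andP[im mu] mmin; exists m; split => //.
    apply/seteqP; split => // y [/=]; rewrite in_itv/= => /andP[iy ym] Sy.
    have /mmin : (S `&` `]i, u]) y.
      by split => //=; rewrite in_itv/= iy (le_trans (ltW ym)).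
    by rewrite leNgt ym.
  move=> A0; exists u; split => //; apply/seteqP; split => // y [/=].
  rewrite in_itv/= => /andP[iy yu] Sy; apply: A0; exists y; split => //=.
  by rewrite in_itv/= iy ltW.
have goodq y : 0 <= y -> y < q -> f y = N y.
  move=> y0 yq; have [yi|iy] := leP y i; first exact: goodi.
  exact: (right_step i0 iq).
have goodqq y : 0 <= y -> y <= q -> f y = N y.
  move=> y0; rewrite le_eqVlt => /predU1P[->|]; last exact: goodq.
  by apply: left_step => //; exact: le_lt_trans iq.
(* The formula holds below [q], so [q] is a lower bound of [E] larger than its infimum [i]. *)
suff /lb_le_inf : lbound E q by move=> /(_ (ex_intro _ u Eu)); rewrite leNgt iq.
move=> y [y0 [yu fy]]; rewrite leNgt; apply/negP => yq.
by apply: fy; exact: goodq.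
Qed.

End OneVariableTheorem.

Section Reach.
Context d {T : measurableType d} {R : realType} (mu : {measure set T -> \bar R}).
Variables (D A : set T) (b : T -> bool) (g : T -> R).
Hypothesis mD : measurable D.
Hypothesis mA : measurable A.
Hypothesis AD : A `<=` D.
Hypothesis bA : forall t, D t -> b t = (t \in A).

(** The many-variable integrand carries [reach] as a factor, the one-variable argument as a domain
    of integration; this lemma and the next translate. *)
Lemma integrable_mul_bool :
  mu.-integrable D (fun t => (g t * (b t)%:R)%:E) ->
  mu.-integrable A (EFin \o g).
Proof.
move=> ig; have : mu.-integrable A (fun t => (g t * (b t)%:R)%:E).
  exact: integrableS ig.
apply: eq_integrable => // t tA /=; rewrite bA ?tA ?mulr1//.
by apply: AD; rewrite inE in tA.
Qed.

Lemma integral_mul_bool :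
  (\int[mu]_(t in D) (g t * (b t)%:R)%:E = \int[mu]_(t in A) (g t)%:E)%E.
Proof.
transitivity (\int[mu]_(t in D `&` A) (g t)%:E)%E; last by rewrite setIidr.
rewrite integral_mkcondr; apply: eq_integral => t /set_mem Dt.
by rewrite bA// patchE; case: ifPn => _; rewrite ?mulr1 ?mulr0.
Qed.

End Reach.

(** The form that can be iterated: all kinds integrate over the same half-line, with [reach] as a
    factor. *)
Theorem regular_formula {R : realType} (S : set R) (f : R -> R)
    (muS : {sigma_finite_measure set (measurableTypeR R) -> \bar R}) (u : R) :
  (forall A, A `<=` S -> A !=set0 -> exists2 m, A m & forall y, A y -> m <= y) ->
  regular_off S f ->
  (forall (D : set (measurableTypeR R)) (F : R -> \bar R),
    measurable D -> measurable_fun D F -> (forall x, D x -> 0 <= F x)%E ->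
    (\int[muS]_(t in D) F t = \esum_(t in S `&` D) F t)%E) ->
  0 <= u ->
  (forall a, (kind_measure muS a).-integrable (`[0, +oo[ : set (measurableTypeR R))
    (fun t => (part S f a t * (reach a t u)%:R)%:E)) ->
  (\sum_a \int[kind_measure muS a]_(t in `[0%R, +oo[)
    (part S f a t * (reach a t u)%:R)%:E)%E = (f u)%:E.
Proof.
move=> minS rf muSE u0 ig.
have sub (c : bool) : [set` Interval (BLeft 0) (BSide c u)] `<=` `[0, +oo[.
  by apply: subset_itvl; case: c; rewrite bnd_simp.
have eo t : `[0, +oo[%classic t -> (t < u) = (t \in `[0, u[%classic).
  by rewrite mem_setE /= !in_itv/= andbT => ->.
have ec t : `[0, +oo[%classic t -> (t <= u) = (t \in `[0, u]%classic).
  by rewrite mem_setE /= !in_itv/= andbT => ->.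
have mo : measurable (`[0, +oo[%classic : set (measurableTypeR R)) by [].
have Id := integrable_mul_bool mo _ (sub true) eo (ig Kd).
have Ir := integrable_mul_bool mo _ (sub true) eo (ig Kr).
have Il := integrable_mul_bool mo _ (sub false) ec (ig Kl).
have {}Id := Id (measurable_itv _); have {}Ir := Ir (measurable_itv _).
have {}Il := Il (measurable_itv _).
rewrite big_kind /=.
have -> : (\int[lebesgue_measure]_(t in `[0%R, +oo[) (part S f Kd t * (t < u)%R%:R)%:E
    = \int[lebesgue_measure]_(t in `[0%R, u[) (part S f Kd t)%:E)%E.
  exact: integral_mul_bool.
have -> : (\int[muS]_(t in `[0%R, +oo[) (part S f Kr t * (t < u)%R%:R)%:E
    = \int[muS]_(t in `[0%R, u[) (part S f Kr t)%:E)%E.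
  exact: integral_mul_bool.
have -> : (\int[muS]_(t in `[0%R, +oo[) (part S f Kl t * (t <= u)%R%:R)%:E
    = \int[muS]_(t in `[0%R, u]) (part S f Kl t)%:E)%E.
  exact: integral_mul_bool.
rewrite integral_dirac// diracE mem_set ?mul1e ?mulr1; last by rewrite /= in_itv/= lexx.
rewrite [in RHS](regular_formula_on minS rf muSE u0 Id Ir Il) /Rintegral.
rewrite !EFinD !fineK ?addeA//; exact: integrable_fin_num.
Qed.

(** * Linear combinations of regular functions and a common exceptional set *)

Section RegularFunctions.
Context {R : realType}.
Implicit Types (S : set R) (f g : R -> R).

(** Points of [S'] outside [S] are points of continuity, or of right continuity at 0, so the
    one-sided limits exist there as well. *)
Lemma regular_off_C1 (S S' : set R) f : S `<=` S' -> C1_off S f -> jumps_on S f ->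
  regular_off S' f.
Proof.
move=> SS' [f1 f10] jf.
have f0 : ~ S 0 -> f t @[t --> 0^'+] --> f 0.
  move=> nS0; have [c [fc _]] := f10 nS0.
  (* Writing [f t] as [f 0] plus [t] times the difference quotient turns the right derivative at 0
     into right continuity. *)
  have h : f 0 + t * (t^-1 * (f t - f 0)) @[t --> 0^'+] --> f 0 + 0 * c.
    apply: cvgD; first exact: cvg_cst.
    by apply: cvgM fc; apply: cvg_at_right_filter; exact: cvg_id.
  rewrite mul0r addr0 in h; apply: cvg_trans h; apply: near_eq_cvg.
  near=> t; rewrite mulrA divff ?mul1r; first by rewrite addrC subrK.
  by rewrite gt_eqF.
have fcont x : 0 < x -> ~ S x -> {for x, continuous f}.
  move=> x0 nSx; have [fx _] := f1 x x0 nSx.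
  by apply: differentiable_continuous; apply/derivable1_diffP.
split.
- move=> x x0 nSx; have [|d c] := f1 x x0; first by move=> /SS'.
  split => //; apply: cvg_trans c; apply: cvg_app.
  by apply: within_subset => y nSy /SS'.
- move=> x x0; have [/jf[]//|nSx] := pselect (S x).
  move: x0; rewrite le_eqVlt => /predU1P[x0|x0].
    by apply/cvg_ex; exists (f 0); rewrite -x0; apply: f0; rewrite x0.
  by apply/cvg_ex; exists (f x); exact: cvg_at_right_filter (fcont x x0 nSx).
- by move=> nS0; apply: f0 => /SS'.
- move=> x x0; have [/jf[_ _ /(_ x0)[]]//|nSx] := pselect (S x).
  by apply/cvg_ex; exists (f x); exact: cvg_at_left_filter (fcont x x0 nSx).
Unshelve. all: by end_near. Qed.

Lemma regular_off_linear S f g c : regular_off S f -> regular_off S g ->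
  regular_off S (fun t => c * f t + g t).
Proof.
move=> [f1 f2 f3 f4] [g1 g2 g3 g4].
have lin (p q : R -> R) (F : set_system R) (FF : Filter F) (l m : R) :
    p t @[t --> F] --> l -> q t @[t --> F] --> m ->
    c * p t + q t @[t --> F] --> c * l + m.
  by move=> fl gm; apply: cvgD gm; apply: cvgM fl; exact: cvg_cst.
have dl x : derivable f x 1 -> derivable g x 1 ->
    is_derive x 1 (fun t => c * f t + g t) (c * f^`()%classic x + g^`()%classic x).
  move=> /derivableP fx /derivableP gx; rewrite !derive1E.
  exact: (@is_deriveD _ _ _ (c \*: f) g).
split.
- move=> x x0 nSx; have [df cf] := f1 x x0 nSx; have [dg cg] := g1 x x0 nSx.
  have d := dl x df dg; split; first exact: ex_derive.
  rewrite derive1E derive_val.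
  have h := lin _ _ _ (within_filter _ (nbhs_filter x)) _ _ cf cg.
  apply: cvg_trans h.
  apply: near_eq_cvg; near=> t.
  have nSt : ~ S t by near: t; exact: withinT.
  have t0 : 0 < t by near: t; apply: cvg_within; exact: lt_nbhsr.
  have [dft _] := f1 t t0 nSt; have [dgt _] := g1 t t0 nSt.
  by rewrite [RHS]derive1E; have h := dl t dft dgt; rewrite derive_val.
- by move=> x x0; apply/cvg_ex; eexists; apply: lin; [exact: f2|exact: g2].
- by move=> nS0; apply: lin; [exact: f3|exact: g3].
- by move=> x x0; apply/cvg_ex; eexists; apply: lin; [exact: f4|exact: g4].
Unshelve. all: by end_near. Qed.

(** [lim] is additive only along convergent functions. [regular_off] provides the limits; for right
    jumps it does so because points of [S] are non-negative. *)
Lemma part_linear S f g c a t : S `<=` [set x | 0 <= x] ->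
  regular_off S f -> regular_off S g ->
  part S (fun t => c * f t + g t) a t = c * part S f a t + part S g a t.
Proof.
move=> S0 [f1 f2 f3 f4] [g1 g2 g3 g4].
case: a => //=.
- rewrite /part; case: ifPn => [_|]; first by rewrite mulr0 addr0.
  rewrite negb_or -ltNge => /andP[/negP tS t0].
  have nSt : ~ S t by move=> /mem_set.
  have [/derivableP df _] := f1 t t0 nSt; have [/derivableP dg _] := g1 t t0 nSt.
  rewrite !derive1E; apply: derive_val; exact: (@is_deriveD _ _ _ (c \*: f) g).
- rewrite /part; case: ifPn => [/set_mem/S0 t0|_]; last by rewrite mulr0 addr0.
  have -> : right_lim (fun t => c * f t + g t) t = c * right_lim f t + right_lim g t.
    apply: cvg_lim => //; apply: cvgD; last exact: g2.
    by apply: cvgM; [exact: cvg_cst|exact: f2].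
  by ring.
- rewrite /part; case: ifPn => [/andP[_ t0]|_]; last by rewrite mulr0 addr0.
  have -> : left_lim (fun t => c * f t + g t) t = c * left_lim f t + left_lim g t.
    apply: cvg_lim => //; apply: cvgD; last exact: g4.
    by apply: cvgM; [exact: cvg_cst|exact: f4].
  by ring.
Qed.

Lemma regular_off_sum S (I : Type) (s : seq I) (c : I -> R) (f : I -> R -> R) :
  S `<=` [set x | 0 <= x] -> (forall k, regular_off S (f k)) ->
  regular_off S (fun t => \sum_(k <- s) c k * f k t) /\
  forall a t, part S (fun t => \sum_(k <- s) c k * f k t) a t =
    \sum_(k <- s) c k * part S (f k) a t.
Proof.
move=> S0 rf; elim: s => [|k s [IH1 IH2]].
  have -> : (fun t => \sum_(k <- [::]) c k * f k t) = cst 0.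
    by apply/funext => t; rewrite big_nil.
  split; last first.
    move=> a t; rewrite big_nil; case: a => //=; rewrite /part.
    - by rewrite derive1_cst; case: ifP.
    - by rewrite /right_lim lim_cst// subrr; case: ifP.
    - by rewrite /left_lim lim_cst// subrr; case: ifP.
  split.
  - move=> x x0 _; split; first exact: derivable_cst.
    by rewrite derive1_cst; under eq_fun do rewrite derive1_cst; exact: cvg_cst.
  - by move=> x x0; exact: is_cvg_cst.
  - by move=> _; exact: cvg_cst.
  - by move=> x x0; exact: is_cvg_cst.
have -> : (fun t => \sum_(i <- k :: s) c i * f i t) =
    (fun t => c k * f k t + (\sum_(i <- s) c i * f i t)).
  by apply/funext => t; rewrite big_cons.
split; first exact: regular_off_linear.
by move=> a t; rewrite part_linear// IH2 big_cons.
Qed.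

End RegularFunctions.

Lemma wo_chain_min {R : realType} (S : set R) :
  wochoice.wo_chain (<=%R : rel R) [pred x | x \in S] ->
  forall A, A `<=` S -> A !=set0 -> exists2 m, A m & forall y, A y -> m <= y.
Proof.
move=> woS A AS [x Ax].
have [|m [[mA mmin] _]] := woS [pred x | x \in A] _ (ex_intro _ x (mem_set Ax)).
  by move=> y; rewrite !inE; exact: AS.
exists m; first by move: mA; rewrite !inE.
by move=> y Ay; apply: mmin; rewrite !inE.
Qed.

(** A finite union of well-ordered sets is well ordered: the least element of [A] is the smallest
    among the minima of its non-empty traces on the sets [S k]. *)
Lemma exists_common_exceptional_set {R : realType} (I : finType) (f : I -> R -> R) :
  (forall k, piecewise_C1 (f k)) ->
  exists S : set R, [/\ S `<=` [set x | 0 <= x], countable S,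
    forall A, A `<=` S -> A !=set0 -> exists2 m, A m & forall y, A y -> m <= y &
    forall k, regular_off S (f k)].
Proof.
move=> /choice[S hS]; exists (\bigcup_k S k); split.
- by move=> x [k _]; have [h _ _ _ _] := hS k; exact: h.
- apply: bigcup_countable; first exact: countableP.
  by move=> k _; have [] := hS k.
- move=> A AS [x Ax].
  have /choice[m hm] k : exists m, (A `&` S k) !=set0 ->
      A m /\ forall y, A y -> S k y -> m <= y.
    have [Ak|] := pselect ((A `&` S k) !=set0); last by exists 0.
    have [_ _ /wo_chain_min woS _ _] := hS k.
    have [m [Am Sm] mm] := woS _ (@subIsetr _ _ _) Ak.
    by exists m => _; split => // y Ay Sy; exact: mm.
  have [k0 _ Sx] := AS x Ax.
  have P0 : `[< (A `&` S k0) !=set0 >] by apply/asboolP; exists x.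
  case: (@Order.TotalTheory.arg_minP _ _ _ k0 (fun k => `[< (A `&` S k) !=set0 >]) m
    P0).
  move=> k /asboolP Pk mink; exists (m k); first by have [] := hm k Pk.
  move=> y Ay; have [i _ Sy] := AS y Ay.
  have Pi : (A `&` S i) !=set0 by exists y.
  apply: (le_trans (mink i _)); first exact/asboolP.
  by have [_ h] := hm i Pi; exact: h.
- move=> k; have [_ _ _ h1 h2] := hS k.
  by apply: regular_off_C1 h1 h2 => x Sx; exists k.
Qed.

(** * Iterated integrals with a kind attached to each coordinate *)

Section TonelliOn.
Local Open Scope ereal_scope.
Context d1 d2 (T1 : measurableType d1) (T2 : measurableType d2) (R : realType).
Variables (m1 : {sigma_finite_measure set T1 -> \bar R})
  (m2 : {sigma_finite_measure set T2 -> \bar R}).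
Variables (D1 : set T1) (D2 : set T2) (f : T1 * T2 -> \bar R).
Hypotheses (mD1 : measurable D1) (mD2 : measurable D2).
Hypothesis mf : measurable_fun setT f.

Let mpatch (A : set T1) (B : set T2) : measurable A -> measurable B ->
  measurable_fun setT (f \_ (A `*` B)).
Proof.
move=> mA mB; apply/(measurable_restrict _ (measurableX mA mB) measurableT).
exact: measurable_funS mf.
Qed.

Let patch2 A B x : x \in A ->
  (fun y => (f \_ (A `*` B)) (x, y)) = (fun y => f (x, y)) \_ B.
Proof.
by move=> xA; apply/funext => y; rewrite !patchE in_setX xA.
Qed.

Lemma measurable_fun_integral_ge0 : (forall z, 0 <= f z) ->
  measurable_fun setT (fun x => \int[m2]_(y in D2) f (x, y)).
Proof.
move=> f0; have := measurable_fun_fubini_tonelli_F (m2 := m2)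
  _ (mpatch measurableT mD2).
have g0 z : 0 <= (f \_ (setT `*` D2)) z by apply: erestrict_ge0 => ? _; exact: f0.
move=> /(_ g0); congr measurable_fun; apply/funext => x.
by rewrite /fubini_F [RHS]integral_mkcond patch2// in_setT.
Qed.

Lemma tonelli_on : (forall z, 0 <= f z) ->
  \int[m1]_(x in D1) \int[m2]_(y in D2) f (x, y) =
  \int[m2]_(y in D2) \int[m1]_(x in D1) f (x, y).
Proof.
move=> f0.
have g0 z : 0 <= (f \_ (D1 `*` D2)) z by apply: erestrict_ge0 => ? _; exact: f0.
have := fubini_tonelli (m1 := m1) (m2 := m2) _ (mpatch mD1 mD2) g0.
congr (_ = _).
  rewrite [RHS]integral_mkcond; apply: eq_integral => x _; rewrite [RHS]patchE.
  case: ifPn => xD; first by rewrite patch2// -integral_mkcond.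
  by rewrite integral0_eq// => y _; rewrite patchE in_setX (negbTE xD).
rewrite [RHS]integral_mkcond; apply: eq_integral => y _; rewrite [RHS]patchE.
case: ifPn => yD.
  rewrite [RHS]integral_mkcond; apply: eq_integral => x _.
  by rewrite !patchE in_setX yD andbT.
by rewrite integral0_eq// => x _; rewrite patchE in_setX (negbTE yD) andbF.
Qed.

End TonelliOn.

Lemma measurable_fun_integral d1 d2 (T1 : measurableType d1) (T2 : measurableType d2)
    (R : realType) (m2 : {sigma_finite_measure set T2 -> \bar R}) (D2 : set T2)
    (f : T1 * T2 -> \bar R) : measurable D2 -> measurable_fun setT f ->
  measurable_fun setT (fun x => \int[m2]_(y in D2) f (x, y))%E.
Proof.
move=> mD2 mf.
have -> : (fun x => \int[m2]_(y in D2) f (x, y))%E =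
    (fun x => \int[m2]_(y in D2) (f^\+ (x, y)) - \int[m2]_(y in D2) (f^\- (x, y)))%E.
  apply/funext => x; rewrite integralE; congr (_ - _)%E; apply: eq_integral => y _.
    by rewrite !funeposE.
  by rewrite !funenegE.
apply: emeasurable_funB; apply: measurable_fun_integral_ge0 => //.
- exact: measurable_funepos.
- exact: measurable_funeneg.
Qed.

Section KindedIntegrals.
Local Open Scope ereal_scope.
Context d {Om : measurableType d} {R : realType} {n : nat}.
Local Notation mT := (measurableTypeR R).
Local Notation state := ('I_n -> kind * R).
Variable mu : 'I_n -> kind -> {sigma_finite_measure set mT -> \bar R}.

Definition upds (p : state) (j : 'I_n) (v : kind * R) : state :=
  fun i => if i == j then v else p i.

(** Kind and point are written into coordinate [j] together, because the integrand [term] depends on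
    both. *)
Definition intk j a (F : state -> \bar R) (p : state) : \bar R :=
  \int[mu j a]_(t in `[0%R, +oo[) F (upds p j (a, t)).

Definition iterk (kappa : 'I_n -> kind) (s : seq 'I_n) (F : state -> \bar R) :=
  foldr (fun j => intk j (kappa j)) F s.

(* Joint measurability in the sample point and the coordinates, tested along arbitrary
   measurable families; this spares a sigma-algebra on the states. *)
Definition mfam (F : Om -> state -> \bar R) : Prop :=
  forall d' (T : measurableType d') (w : T -> Om) (kappa : 'I_n -> kind)
    (y : 'I_n -> T -> R),
  measurable_fun setT w -> (forall i, measurable_fun setT (y i)) ->
  measurable_fun setT (fun t => F (w t) (fun i => (kappa i, y i t))).

Lemma updsC p i j v v' : i != j -> upds (upds p i v) j v' = upds (upds p j v') i v.
Proof.
move=> ij; apply/funext => k; rewrite /upds.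
by case: (eqVneq k j) => // ->; case: eqVneq => // ji; rewrite ji eqxx in ij.
Qed.

Lemma mfam_section F (w : Om) (p : state) j a : mfam F ->
  measurable_fun setT (fun t : mT => F w (upds p j (a, t))).
Proof.
move=> mF; have := mF _ mT (cst w) (fun i => if i == j then a else (p i).1)
  (fun i (t : mT) => if i == j then t else (p i).2).
move=> /(_ (measurable_cst _)).
have my i : measurable_fun setT (fun t : mT => if i == j then t else (p i).2).
  by case: (i == j); [exact: measurable_id|exact: measurable_cst].
move=> /(_ my); congr measurable_fun; apply/funext => t; congr F.
by apply/funext => i; rewrite /upds; case: ifP => //; case: (p i).
Qed.

Lemma intk_ge0 j a F p : (forall q, 0 <= F q) -> 0 <= intk j a F p.
Proof. by move=> F0; apply: integral_ge0 => t _; exact: F0. Qed.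

Lemma intk_mfam j a F : mfam F -> mfam (fun w => intk j a (F w)).
Proof.
move=> mF d' T w kappa y mw my; rewrite /intk.
pose f (z : T * mT) := F (w z.1) (upds (fun i => (kappa i, y i z.1)) j (a, z.2)).
apply: (@measurable_fun_integral _ _ T mT R (mu j a) _ f) => //.
have := mF _ (T * mT)%type (w \o fst) (fun i => if i == j then a else kappa i)
  (fun i z => if i == j then z.2 else y i z.1).
move=> /(_ (measurableT_comp mw measurable_fst)).
have my' i : measurable_fun setT (fun z : T * mT => if i == j then z.2 else y i z.1).
  case: (i == j); first exact: measurable_snd.
  exact: (measurableT_comp (my i) measurable_fst).
move=> /(_ my'); congr measurable_fun; apply/funext => z; rewrite /f/=; congr F.
by apply/funext => i; rewrite /upds; case: ifP.
Qed.

Lemma intkC i j a b F w p : i != j -> mfam F -> (forall w q, 0 <= F w q) ->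
  intk i a (intk j b (F w)) p = intk j b (intk i a (F w)) p.
Proof.
move=> ij mF F0; rewrite /intk.
pose f (z : mT * mT) := F w (upds (upds p i (a, z.1)) j (b, z.2)).
have := @tonelli_on _ _ mT mT R (mu i a) (mu j b) `[0%R, +oo[%classic `[0%R,
  +oo[%classic f.
move=> /(_ (measurable_itv _) (measurable_itv _)) h; rewrite [LHS]h; last by move=> z;
  exact: F0.
  by apply: eq_integral => t _; apply: eq_integral => s _; rewrite /f updsC.
have := mF _ (mT * mT)%type (cst w)
  (fun k => if k == j then b else if k == i then a else (p k).1)
  (fun k z => if k == j then z.2 else if k == i then z.1 else (p k).2).
move=> /(_ (measurable_cst _)).
have my k : measurable_fun setT
    (fun z : mT * mT => if k == j then z.2 else if k == i then z.1 else (p k).2).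
  by case: (k == j); last case: (k == i);
    [exact: measurable_snd|exact: measurable_fst|exact: measurable_cst].
move=> /(_ my); congr measurable_fun; apply/funext => z; rewrite /f; congr F.
by apply/funext => k; rewrite /upds; do 2?[case: ifP => //]; case: (p k).
Qed.

Lemma iterk_ge0 kappa s F p : (forall q, 0 <= F q) -> 0 <= iterk kappa s F p.
Proof. by move=> F0; elim: s p => //= j s IH p; exact: intk_ge0. Qed.

Lemma iterk_mfam kappa s F : mfam F -> mfam (fun w => iterk kappa s (F w)).
Proof. by move=> mF; elim: s => //= j s IH; exact: intk_mfam. Qed.

Lemma iterk_rem kappa s j F w : uniq s -> j \in s -> mfam F ->
  (forall w q, 0 <= F w q) ->
  iterk kappa s (F w) = intk j (kappa j) (iterk kappa (rem j s) (F w)).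
Proof.
move=> us js mF F0; elim: s us js => //= i s IH /andP[ins us].
rewrite inE; case: (eqVneq j i) => [->//|ji] /= js.
rewrite IH//=; apply/funext => p.
rewrite (@intkC i j _ _ (fun w => iterk kappa (rem j s) (F w))) ?(eq_sym i)//.
- exact: iterk_mfam.
- by move=> w' q; exact: iterk_ge0.
Qed.

(** [A_gen] puts the derivative coordinates outside and the jump coordinates inside, whereas the
    expansion follows [enum 'I_n]; this lemma reconciles the two orders. *)
Lemma iterk_perm kappa s s' F w : uniq s -> perm_eq s s' -> mfam F ->
  (forall w q, 0 <= F w q) -> iterk kappa s (F w) = iterk kappa s' (F w).
Proof.
move=> us ss' mF F0; elim: s' s us ss' => [|j s' IH] s us ss'.
  by have /nilP -> : nilp s by rewrite /nilp (perm_size ss').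
have js : j \in s by rewrite (perm_mem ss') mem_head.
rewrite (iterk_rem _ _ us js mF F0) /=; congr intk; apply: IH; first exact: rem_uniq.
by have := perm_to_rem js; rewrite perm_sym => /perm_trans/(_ ss'); rewrite perm_cons.
Qed.

Lemma eq_iterk kappa s F G p :
  (forall q, (forall i, i \notin s -> q i = p i) ->
    (forall i, i \in s -> (q i).1 = kappa i /\ (0 <= (q i).2)%R) -> F q = G q) ->
  iterk kappa s F p = iterk kappa s G p.
Proof.
elim: s p => [|j s IH] p FG /=; first by apply: FG.
apply: eq_integral => t /set_mem /=; rewrite in_itv/= andbT => t0; apply: IH => q q1 q2.
apply: FG => i; rewrite inE.
  by rewrite negb_or => /andP[ij /q1 ->]; rewrite /upds (negbTE ij).
have [is_ _|nis] := boolP (i \in s); first exact: q2.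
by rewrite orbF => /eqP ij; rewrite (q1 _ nis) ij /upds eqxx.
Qed.

Lemma mfam_integral (Q : probability Om R) F : mfam F ->
  mfam (fun _ q => \int[Q]_w F w q).
Proof.
move=> mF d' T w kappa y mw my.
apply: (@measurable_fun_integral _ _ T Om R Q setT
  (fun z => F z.2 (fun i => (kappa i, y i z.1)))) => //.
apply: (mF _ (T * Om)%type snd kappa (fun i z => y i z.1)); first exact: measurable_snd.
by move=> i; exact: (measurableT_comp (my i) measurable_fst).
Qed.

Lemma integral_iterk (Q : probability Om R) kappa s F p : mfam F ->
  (forall w q, 0 <= F w q) ->
  \int[Q]_w iterk kappa s (F w) p = iterk kappa s (fun q => \int[Q]_w F w q) p.
Proof.
move=> mF F0; elim: s p => //= j s IH p.
pose f (z : Om * mT) := iterk kappa s (F z.1) (upds p j (kappa j, z.2)).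
have := @tonelli_on _ _ Om mT R Q (mu j (kappa j)) setT `[0%R, +oo[%classic f.
move=> /(_ measurableT (measurable_itv _)) h; rewrite [LHS]h.
- by rewrite /intk; apply: eq_integral => t _; rewrite -IH.
- have := iterk_mfam kappa s mF.
  move=> /(_ _ (Om * mT)%type fst (fun i => if i == j then kappa j else (p i).1)
    (fun i z => if i == j then z.2 else (p i).2) measurable_fst).
  have my i : measurable_fun setT (fun z : Om * mT => if i == j then z.2 else (p i).2).
    by case: (i == j); [exact: measurable_snd|exact: measurable_cst].
  move=> /(_ my); congr measurable_fun; apply/funext => z; rewrite /f; congr iterk.
  by apply/funext => i; rewrite /upds; case: ifP => //; case: (p i).
- by move=> z; exact: iterk_ge0.
Qed.

End KindedIntegrals.

(** * Expansion of the payoff and of its expectation *)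

Section AllKinds.
Local Open Scope ereal_scope.
Context d {Om : measurableType d} {R : realType} {n : nat}.
Local Notation mT := (measurableTypeR R).
Local Notation state := ('I_n -> kind * R).
Variable mu : 'I_n -> kind -> {sigma_finite_measure set mT -> \bar R}.

(** The sum over kinds sits inside each coordinate, as the one-variable formula delivers it;
    [iterK_sum] later pulls all these sums outside. *)
Definition intK j (F : state -> \bar R) (p : state) : \bar R :=
  \sum_(a : kind) intk mu j a F p.

Definition iterK (s : seq 'I_n) (F : state -> \bar R) := foldr intK F s.

Lemma iterK_ge0 s F p : (forall q, 0 <= F q) -> 0 <= iterK s F p.
Proof.
move=> F0; elim: s p => //= j s IH p.
by apply: sume_ge0 => a _; exact: intk_ge0.
Qed.

Lemma iterK_mfam s (F : Om -> state -> \bar R) :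
  mfam F -> mfam (fun w => iterK s (F w)).
Proof.
move=> mF; elim: s => //= j s IH d' T w kappa y mw my.
by apply: emeasurable_sum => a; exact: (intk_mfam mu j a IH).
Qed.

Lemma le_iterK s (F G : Om -> state -> \bar R) w p : mfam F -> mfam G ->
  (forall w q, 0 <= F w q) -> (forall w q, F w q <= G w q) ->
  iterK s (F w) p <= iterK s (G w) p.
Proof.
move=> mF mG F0 FG; elim: s p => //= j s IH p; apply: lee_sum => a _.
apply: ge0_le_integral => //.
- by move=> t _; exact: iterK_ge0.
- apply: measurable_funTS; exact: (mfam_section w p j a (iterK_mfam s mF)).
- apply: measurable_funTS; exact: (mfam_section w p j a (iterK_mfam s mG)).
Qed.

(** Assignments stay total functions: outside [s] they must repeat the kinds stored in [p], so that
    each choice of kinds on [s] is counted exactly once. *)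
Definition kind_agree (s : seq 'I_n) (p : state) (kappa : {ffun 'I_n -> kind}) :=
  [forall i, (i \notin s) ==> (kappa i == (p i).1)].

Lemma kind_agree_upds j s p a t kappa : j \notin s ->
  kind_agree s (upds p j (a, t)) kappa = kind_agree (j :: s) p kappa && (kappa j == a).
Proof.
move=> js; apply/forallP/andP => [h|[/forallP h kj] i]; last first.
  apply/implyP => nis; rewrite /upds; case: (eqVneq i j) => [->//|ij].
  by have /implyP := h i; apply; rewrite inE negb_or ij.
split; last by have /implyP/(_ js) := h j; rewrite /upds eqxx.
apply/forallP => i; apply/implyP; rewrite inE negb_or => /andP[ij nis].
by have /implyP/(_ nis) := h i; rewrite /upds (negbTE ij).
Qed.

Lemma iterK_sum s (F : Om -> state -> \bar R) w p : uniq s -> mfam F ->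
  (forall w q, 0 <= F w q) ->
  iterK s (F w) p = \sum_(kappa | kind_agree s p kappa) iterk mu kappa s (F w) p.
Proof.
move=> us mF F0; elim: s us p => [_ p|j s IH /= /andP[js us] p].
  rewrite (big_pred1 [ffun i => (p i).1])// => kappa; apply/forallP/eqP => [h|-> i].
    by apply/ffunP => i; rewrite ffunE; have /implyP/(_ isT)/eqP := h i.
  by rewrite ffunE eqxx implybT.
(* Sorting the assignments by their value at [j] produces the sum over kinds of the outermost
   coordinate. *)
rewrite (partition_big (fun kappa : {ffun 'I_n -> kind} => kappa j) xpredT)//=.
apply: eq_bigr => a _; rewrite /intk.
under eq_integral do rewrite IH//.
under eq_integral do under eq_bigl do rewrite kind_agree_upds//.
under eq_integral do rewrite -big_filter.
rewrite ge0_integral_sum//; last 2 first.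
- move=> kappa; apply: measurable_funTS.
  exact: (mfam_section w p j a (iterk_mfam mu kappa s mF)).
- by move=> kappa t _; exact: iterk_ge0.
by rewrite big_filter; apply: eq_bigr => kappa /andP[_ /eqP ->].
Qed.

End AllKinds.

Lemma sumeB_fin (R : realType) (I : finType) (x y : I -> \bar R) :
  (forall a, x a \is a fin_num) -> (forall a, y a \is a fin_num) ->
  (\sum_a x a - \sum_a y a = \sum_a (x a - y a))%E.
Proof.
move=> xf yf.
under eq_bigr do rewrite -(fineK (xf _)).
under [X in (_ - X)%E]eq_bigr do rewrite -(fineK (yf _)).
rewrite !sumEFin -EFinB -sumrB -sumEFin; apply: eq_bigr => a _.
by rewrite EFinB !fineK.
Qed.

Lemma measurable_reach d (T : measurableType d) (R : realType) a (y u : T -> R) :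
  measurable_fun setT y -> measurable_fun setT u ->
  measurable_fun setT (fun t => (reach a (y t) (u t))%:R : R).
Proof.
move=> my mu; have mb (b : T -> bool) : measurable_fun setT b ->
    measurable_fun setT (fun t => (b t)%:R : R).
  move=> mb; rewrite (_ : (fun t => _) = fun t => if b t then 1 else 0).
    by apply: measurable_fun_ifT => //; exact: measurable_cst.
  by apply/funext => t; case: (b t).
apply: mb; case: a.
- exact: measurable_cst.
- exact: measurable_fun_ltr.
- exact: measurable_fun_ltr.
- exact: measurable_fun_ler.
Qed.

Section PayoffExpansion.
Local Open Scope ereal_scope.
Context d {Om : measurableType d} {R : realType} {n : nat} {I : finType}.
Local Notation mT := (measurableTypeR R).
Local Notation state := ('I_n -> kind * R).
Variables (S : 'I_n -> set R) (f : I -> 'I_n -> R -> R).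
Variable muS : 'I_n -> {sigma_finite_measure set mT -> \bar R}.
Variable X : 'I_n -> Om -> R.
Hypothesis S_ge0 : forall j, S j `<=` [set x | (0 <= x)%R].
Hypothesis S_countable : forall j, countable (S j).
Hypothesis S_min : forall j A, A `<=` S j -> A !=set0 ->
  exists2 m, A m & forall y, A y -> (m <= y)%R.
Hypothesis f_regular : forall k j, regular_off (S j) (f k j).
Hypothesis muSE : forall j (D : set mT) (F : R -> \bar R),
  measurable D -> measurable_fun D F -> (forall x, D x -> 0 <= F x) ->
  \int[muS j]_(t in D) F t = \esum_(t in S j `&` D) F t.
Hypothesis mX : forall j, measurable_fun setT (X j).

Definition factor (p : state) k j : R := part (S j) (f k j) (p j).1 (p j).2.

Definition reachable w (p : state) j : bool := reach (p j).1 (p j).2 (X j w).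

(** The indicator of the box is distributed over the factors, so that the share of each coordinate
    is a one-variable integrand; [termE] collects it again. *)
Definition term w (p : state) : R :=
  (\sum_k \prod_j (factor p k j * (reachable w p j)%:R))%R.

Lemma measurable_factor d' (T : measurableType d') (kappa : 'I_n -> kind)
    (y : 'I_n -> T -> R) k j : measurable_fun setT (y j) ->
  measurable_fun setT (fun t => factor (fun i => (kappa i, y i t)) k j).
Proof.
move=> my; rewrite /factor /=.
exact: (measurableT_comp (measurable_part (kappa j) (S_countable j) (f_regular k j))
  my).
Qed.

Lemma measurable_reachable d' (T : measurableType d') (kappa : 'I_n -> kind)
    (y : 'I_n -> T -> R) (w : T -> Om) j : measurable_fun setT w ->
  measurable_fun setT (y j) ->
  measurable_fun setT
    (fun t => (reachable (w t) (fun i => (kappa i, y i t)) j)%:R : R).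
Proof.
move=> mw my; apply: (@measurable_reach _ _ _ (kappa j) (y j) (X j \o w)) => //.
exact: measurableT_comp.
Qed.

Lemma measurable_term d' (T : measurableType d') (kappa : 'I_n -> kind)
    (y : 'I_n -> T -> R) (w : T -> Om) : measurable_fun setT w ->
  (forall j, measurable_fun setT (y j)) ->
  measurable_fun setT (fun t => term (w t) (fun i => (kappa i, y i t))).
Proof.
move=> mw my; apply: measurable_sum => k; apply: measurable_prod => j _.
apply: measurable_funM; first exact: measurable_factor.
exact: measurable_reachable.
Qed.

Lemma term_mfam (g : R -> R) : measurable_fun setT g ->
  mfam (fun w p => (g (term w p))%:E).
Proof.
move=> mg d' T w kappa y mw my; apply/measurable_EFinP.
by apply: (measurableT_comp mg); exact: measurable_term.
Qed.

Let mu j a := kind_measure (muS j) a.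

Let V (g : R -> R) s w p := iterK mu s (fun q => (g (term w q))%:E) p.

Let pos (x : R) := Num.max x 0%R.
Let neg (x : R) := Num.max (- x)%R 0%R.

Let mpos : measurable_fun setT (pos : R -> R).
Proof. by apply: measurable_maxr => //; exact: measurable_cst. Qed.
Let mneg : measurable_fun setT (neg : R -> R).
Proof. by apply: measurable_maxr; [exact: measurable_funN|exact: measurable_cst]. Qed.
Let mabs : measurable_fun setT (Num.norm : R -> R).
Proof. exact: normr_measurable. Qed.

Let mixedprod w (s : seq 'I_n) (p : state) : R := (\sum_k \prod_j
  (if j \in s then f k j (X j w) else factor p k j * (reachable w p j)%:R))%R.

(* Only the coordinates in [s] are expanded; those outside keep the kind and the point
   given by [p], and act as coefficients of the sum over [k]. *)
Lemma iterK_term_expansion s w p : uniq s -> (forall j, (0 <= X j w)%R) ->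
  iterK mu s (fun q => (`|term w q|%R)%:E) p < +oo ->
  [/\ iterK mu s (fun q => (Num.max (term w q) 0%R)%:E) p \is a fin_num,
     iterK mu s (fun q => (Num.max (- term w q)%R 0%R)%:E) p \is a fin_num &
     iterK mu s (fun q => (Num.max (term w q) 0%R)%:E) p -
     iterK mu s (fun q => (Num.max (- term w q)%R 0%R)%:E) p = (mixedprod w s p)%:E].
Proof.
move=> us Xw; rewrite -/(V pos s w p) -/(V neg s w p) -/(V Num.norm s w p).
have pos0 x : (0 <= pos x)%R by rewrite /pos le_max lexx orbT.
have neg0 x : (0 <= neg x)%R by rewrite /neg le_max lexx orbT.
have posle x : (pos x <= `|x|)%R by rewrite /pos ge_max ler_norm normr_ge0.
have negle x : (neg x <= `|x|)%R by rewrite /neg ge_max -normrN ler_norm normr_ge0.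
have Vge0 (g : R -> R) s' q : (forall x, 0 <= g x)%R -> 0 <= V g s' w q.
  by move=> g0; apply: iterK_ge0 => ?; rewrite lee_fin.
have Vle (g : R -> R) s' q : measurable_fun setT g -> (forall x, 0 <= g x)%R ->
    (forall x, g x <= `|x|)%R -> V g s' w q <= V Num.norm s' w q.
  move=> mg g0 gle; apply: (le_iterK mu s' w q (term_mfam mg) (term_mfam mabs)).
  - by move=> w' q'; rewrite lee_fin.
  - by move=> w' q'; rewrite lee_fin.
have mV (g : R -> R) s' q j a : measurable_fun setT g ->
    measurable_fun setT (fun t : mT => V g s' w (upds q j (a, t))).
  by move=> mg; exact: (mfam_section w q j a (iterK_mfam mu s' (term_mfam mg))).
have fin (g : R -> R) s' q : measurable_fun setT g -> (forall x, 0 <= g x)%R ->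
    (forall x, g x <= `|x|)%R -> V Num.norm s' w q < +oo -> V g s' w q \is a fin_num.
  move=> mg g0 gle Vn; rewrite ge0_fin_numE; last exact: Vge0.
  by apply: le_lt_trans Vn; exact: Vle.
move=> Vs; split; [exact: fin|exact: fin|].
elim: s us p Vs => [_ p _|j s IH /= /andP[js us] p Vs].
  (* With no coordinate expanded, the mixed product is [term], the difference of its two parts. *)
  rewrite /V /= -EFinB; congr EFin.
  have -> (x : R) : (pos x - neg x)%R = x.
    by rewrite /pos /neg; case: (leP x 0%R) => x0; case: (leP (- x)%R 0%R) => ?; lra.
  by [].
have Va a : \int[mu j a]_(t in `[0%R, +oo[) V Num.norm s w (upds p j (a, t)) < +oo.
  move: Vs; rewrite /V /= /intK (bigD1 a)//=; apply: le_lt_trans.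
  by rewrite leeDl// sume_ge0// => b _; apply: intk_ge0 => q; exact: Vge0.
have ig (g : R -> R) a : measurable_fun setT g -> (forall x, 0 <= g x)%R ->
    (forall x, g x <= `|x|)%R ->
    (mu j a).-integrable (`[0%R, +oo[ : set mT) (fun t => V g s w (upds p j (a, t))).
  move=> mg g0 gle; apply/integrableP; split;
    first exact: measurable_funTS (mV _ _ _ _ _ mg).
  apply: le_lt_trans (Va a); apply: ge0_le_integral => //.
  - by apply: measurableT_comp => //; exact: measurable_funTS (mV _ _ _ _ _ mg).
  - exact: measurable_funTS (mV _ _ _ _ _ mabs).
  - by move=> t _; rewrite gee0_abs; [exact: Vle|exact: Vge0].
(* Everything outside coordinate [j] is frozen into the coefficient [C k], and the one-variable
   formula is applied to the combination of the [f k j] with these coefficients. *)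
pose C k : R := (\prod_(i | i != j)
  (if i \in s then f k i (X i w) else factor p k i * (reachable w p i)%:R))%R.
pose G a (t : mT) : R := ((part (S j) (fun x => \sum_k C k * f k j x) a t) *
  (reach a t (X j w))%:R)%R.
have [regF partF] := regular_off_sum (index_enum I) C (@S_ge0 j) (fun k => f_regular k
  j).
have GE a t : G a t = mixedprod w s (upds p j (a, t)).
  rewrite /G partF mulr_suml; apply: eq_bigr => k _.
  rewrite (bigD1 j)//= (negbTE js) -mulrA [LHS]mulrC; congr (_ * _)%R.
    by rewrite /factor /reachable /upds eqxx.
  by apply: eq_bigr => i ij; rewrite /factor /reachable /upds (negbTE ij).
have mG a : measurable_fun (`[0%R, +oo[ : set mT) (EFin \o G a).
  apply: measurable_funTS; apply/measurable_EFinP; apply: measurable_funM.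
    exact: measurable_part.
  by apply: measurable_reach; [exact: measurable_id|exact: measurable_cst].
have mD : measurable (`[0%R, +oo[%classic : set mT) by [].
(* The induction hypothesis is available only where the inner integral of [|term|] is finite, that
   is, almost everywhere for the measure of kind [a]. This still gives the integrability and the
   integral of [G a]. *)
have aeG a : ae_eq (mu j a) (`[0%R, +oo[%classic : set mT)
    (fun t => V pos s w (upds p j (a, t)) - V neg s w (upds p j (a, t))) (EFin \o G a).
  have := integrable_ae mD (ig Num.norm a mabs (@normr_ge0 _ _) (fun x => lexx _)).
  apply: filterS => t /= h Dt; rewrite GE; apply: IH => //.
  by rewrite -ge0_fin_numE; [exact: h|exact: Vge0].
have igB a := integrableB mD (ig pos a mpos pos0 posle)
  (ig neg a mneg neg0 negle).
have igG a : (mu j a).-integrable (`[0%R, +oo[ : set mT) (EFin \o G a).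
  apply/integrableP; split => //.
  have /integrableP[mB] := igB a.
  rewrite (ae_eq_integral (fun t => `|(G a t)%:E|))//.
  - by apply: measurableT_comp => //; exact: mB.
  - by apply: measurableT_comp => //; exact: mG.
  - by apply: filterS (aeG a) => t h Dt; rewrite h.
have := regular_formula (@S_min j) regF (@muSE j) (Xw j) igG.
have -> : mixedprod w (j :: s) p = (\sum_k C k * f k j (X j w))%R.
  apply: eq_bigr => k _; rewrite (bigD1 j)//= mem_head mulrC; congr (_ * _)%R.
  by apply: eq_bigr => i ij; rewrite inE (negbTE ij).
move=> <-; rewrite /V /= /intK sumeB_fin.
- apply: eq_bigr => a _; have /integrableP[mB _] := igB a.
  by rewrite -(ae_eq_integral _ _ mD mB (mG a) (aeG a)) integralB//; exact: ig.
- by move=> a; apply: integrable_fin_num => //; exact: ig.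
- by move=> a; apply: integrable_fin_num => //; exact: ig.
Qed.

Definition weight (p : state) : R := (\sum_k \prod_j factor p k j)%R.

Lemma termE w p : term w p = (weight p * [forall j, reachable w p j]%:R)%R.
Proof.
rewrite /term /weight mulr_suml; apply: eq_bigr => k _; rewrite big_split/=;
  congr (_ * _)%R.
case: (boolP [forall j, _]) => [/forallP h|]; first by rewrite big1// => j _; rewrite h.
by rewrite negb_forall => /existsP[j nj]; rewrite (bigD1 j)//= (negbTE nj) mul0r.
Qed.

Variable Q : probability Om R.

Let A (g : R -> R) (kappa : {ffun 'I_n -> kind}) : \bar R :=
  iterk mu kappa (enum 'I_n) (fun q => \int[Q]_w (g (term w q))%:E) (fun _ => (Kz,
    0%R)).

(** By Tonelli the expected iterated integral of [|term|] is the sum of the [A Num.norm kappa],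
    hence finite, so the pathwise expansion holds almost surely and its two parts can be integrated
    separately. Their finiteness is part of the conclusion because the comparison with [A_fun]
    subtracts them again. *)
Lemma expectation_expansion (H : Om -> R) :
  measurable_fun setT H ->
  {ae Q, forall w, forall j, (0 <= X j w)%R} ->
  {ae Q, forall w, H w = \sum_k \prod_j f k j (X j w)}%R ->
  (forall kappa, A Num.norm kappa < +oo) ->
  \int[Q]_w (H w)%:E =
  \sum_kappa (A (fun x => Num.max x 0)%R kappa - A (fun x => Num.max (- x) 0)%R kappa)
    /\
  forall kappa, A (fun x => Num.max x 0)%R kappa \is a fin_num /\
                A (fun x => Num.max (- x) 0)%R kappa \is a fin_num.
Proof.
move=> mH X0 HE Afin; rewrite -/pos -/neg.
have pos0 x : (0 <= pos x)%R by rewrite /pos le_max lexx orbT.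
have neg0 x : (0 <= neg x)%R by rewrite /neg le_max lexx orbT.
have posle x : (pos x <= `|x|)%R by rewrite /pos ge_max ler_norm normr_ge0.
have negle x : (neg x <= `|x|)%R by rewrite /neg ge_max -normrN ler_norm normr_ge0.
pose p0 : state := fun _ => (Kz, 0%R); pose en := enum 'I_n.
have uen : uniq en by exact: enum_uniq.
have mV (g : R -> R) : measurable_fun setT g ->
  measurable_fun setT (fun w => V g en w p0).
  move=> mg; have := iterK_mfam mu en (term_mfam mg).
  by move=> /(_ _ Om id (fun _ => Kz) (fun _ _ => 0%R)); apply.
have V0 (g : R -> R) w : (forall x, 0 <= g x)%R -> 0 <= V g en w p0.
  by move=> g0; apply: iterK_ge0 => q; rewrite lee_fin.
have EV (g : R -> R) : measurable_fun setT g -> (forall x, 0 <= g x)%R ->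
    \int[Q]_w V g en w p0 = \sum_kappa A g kappa.
  move=> mg g0.
  have F0 w q : 0 <= (g (term w q))%:E by rewrite lee_fin.
  transitivity (\int[Q]_w \sum_(kappa : {ffun 'I_n ->
    kind}) iterk mu kappa en (fun q => (g (term w q))%:E) p0).
    apply: eq_integral => w _.
    rewrite /V (iterK_sum mu w p0 uen (term_mfam mg) F0).
    (* All coordinates are listed in [en], so [kind_agree] excludes no assignment. *)
    by apply: eq_bigl => kappa; apply/forallP => i; rewrite mem_enum.
  rewrite ge0_integral_sum//.
  - by apply: eq_bigr => kappa _; rewrite (integral_iterk mu Q _ _ _ (term_mfam mg) F0).
  - move=> kappa; have := iterk_mfam mu (kappa : {ffun _ -> _}) en (term_mfam mg).
    by move=> /(_ _ Om id (fun _ => Kz) (fun _ _ => 0%R)); apply.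
  - by move=> kappa w _; exact: iterk_ge0.
have A0 (g : R -> R) kappa : (forall x, 0 <= g x)%R -> 0 <= A g kappa.
  by move=> g0; apply: iterk_ge0 => q; apply: integral_ge0 => w _; rewrite lee_fin.
have Vabs : \int[Q]_w V Num.norm en w p0 < +oo.
  rewrite EV//.
  by apply: lte_sum_pinfty => kappa _; exact: Afin.
have igV (g : R -> R) : measurable_fun setT g -> (forall x, 0 <= g x)%R ->
    (forall x, g x <= `|x|)%R -> Q.-integrable setT (fun w => V g en w p0).
  move=> mg g0 gle; apply/integrableP; split; first exact: mV.
  apply: le_lt_trans Vabs; apply: ge0_le_integral => //.
  - by apply: measurableT_comp => //; exact: mV.
  - exact: mV.
  - move=> w _; rewrite gee0_abs; last exact: V0.
    apply: (le_iterK mu en w p0 (term_mfam mg) (term_mfam mabs)) => // w' q.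
      by rewrite lee_fin.
    by rewrite lee_fin.
have EVfin (g : R -> R) : measurable_fun setT g -> (forall x, 0 <= g x)%R ->
    (forall x, g x <= `|x|)%R -> forall kappa, A g kappa \is a fin_num.
  move=> mg g0 gle kappa; rewrite ge0_fin_numE; last exact: A0.
  have /integrableP[_] := igV g mg g0 gle.
  under eq_integral do rewrite gee0_abs ?V0//.
  rewrite EV// (bigD1 kappa)//=; apply: le_lt_trans.
  by rewrite leeDl// sume_ge0// => ? _; exact: A0.
split; last by move=> kappa; split; exact: EVfin.
have aeN : {ae Q, forall w, V Num.norm en w p0 \is a fin_num}.
  have := integrable_ae measurableT (igV Num.norm mabs (@normr_ge0 _ _) (fun x => lexx
    _)).
  by apply: filterS => w; apply.
rewrite -sumeB_fin; [|exact: EVfin|exact: EVfin].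
rewrite -!EV// -integralB//; [|exact: igV|exact: igV].
apply: ae_eq_integral => //.
- exact/measurable_EFinP.
- by apply: emeasurable_funB; exact: mV.
apply: filterS3 X0 HE aeN => w Xw -> Vw _.
have Vfin : V Num.norm en w p0 < +oo.
  by rewrite -ge0_fin_numE//; exact: (V0 Num.norm).
have [_ _ ->] := iterK_term_expansion uen Xw Vfin.
congr EFin; apply: eq_bigr => k _; apply: eq_bigr => j _; by rewrite mem_enum.
Qed.

End PayoffExpansion.

(** * Comparison with [int_coords], [sum_coords] and [mixed_op] *)

Section CountableModification.
Local Open Scope ereal_scope.
Context {R : realType}.
Local Notation mT := (measurableTypeR R).
Variables (D N : set mT) (U V : mT -> \bar R).
Hypothesis mD : measurable D.
Hypothesis N_countable : countable N.
Hypothesis mV : measurable_fun setT V.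
Hypothesis UV : forall t, D t -> ~ N t -> U t = V t.

Let mN (A : set mT) : A `<=` N -> measurable A.
Proof.
move=> AN; apply: countable_measurable => //.
by apply: sub_countable N_countable; exact: subset_card_le.
Qed.

(** Every subset of the countable set [N] is measurable, so the values of [U] on it are harmless. *)
Lemma measurable_fun_off_countable : measurable_fun D U.
Proof.
move=> _ B mB.
have -> : D `&` U @^-1` B =
    (D `&` V @^-1` B `&` ~` N) `|` (D `&` U @^-1` B `&` N).
  apply/seteqP; split => t.
    move=> [Dt Bt]; have [Nt|nNt] := pselect (N t); first by right.
    by left; split => //; split => //=; rewrite -UV.
  case=> [[[Dt Bt] nNt]|[//]]; split => //=; by rewrite UV.
apply: measurableU; last by apply: mN; exact: subIsetr.
apply: measurableI; last by apply: measurableC; exact: mN.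
by apply: measurableI => //; rewrite -[X in measurable X]setTI; exact: mV.
Qed.

Lemma integral_off_countable :
  \int[lebesgue_measure]_(t in D) U t = \int[lebesgue_measure]_(t in D) V t.
Proof.
apply: ae_eq_integral => //; first exact: measurable_fun_off_countable.
  exact: measurable_funTS.
exists N; split; first exact: mN.
  by apply: countable_lebesgue_measure0.
by move=> t /= /not_implyP[Dt UVt]; apply: contrapT => nNt; apply: UVt; exact: UV.
Qed.

End CountableModification.

(** * Coordinate integrals and unordered sums as iterated integrals *)

Section Rows.
Local Open Scope ereal_scope.
Context {R : realType} {n : nat}.
Local Notation mT := (measurableTypeR R).
Local Notation state := ('I_n -> kind * R).
Variables (S : 'I_n -> set R) (muS : 'I_n -> {sigma_finite_measure set mT -> \bar R}).
Hypothesis S_countable : forall j, countable (S j).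
Hypothesis muSE : forall j (D : set mT) (F : R -> \bar R),
  measurable D -> measurable_fun D F -> (forall x, D x -> 0 <= F x) ->
  \int[muS j]_(t in D) F t = \esum_(t in S j `&` D) F t.

Let mu j a := kind_measure (muS j) a.

Variable kappa : 'I_n -> kind.

Definition row_state (y : 'rV[R]_n) : state := fun i => (kappa i, y ord0 i).

Lemma row_state_upd y j t :
  row_state (Defs.upd y j t) = upds (row_state y) j (kappa j, t).
Proof.
by apply/funext => i; rewrite /row_state /upds mxE; case: eqVneq => [->|].
Qed.

Lemma iterk_agree s F p p' : (forall i, i \notin s -> p i = p' i) ->
  iterk mu kappa s F p = iterk mu kappa s F p'.
Proof.
elim: s p p' => [|j s IH] p p' pp' /=; first by congr F; apply/funext => i; exact: pp'.
apply: eq_integral => t _; apply: IH => i nis; rewrite /upds;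
  case: (eqVneq i j) => // ij.
by apply: pp'; rewrite inE negb_or ij.
Qed.

(** A deterministic integrand is a family over a one-point sample space, so the lemmas on [mfam]
    apply to it. *)
Let mconst (G : state -> \bar R) := mfam (fun _ : unit => G).

Let msec (G : state -> \bar R) p j a : mconst G ->
  measurable_fun setT (fun t : mT => G (upds p j (a, t))).
Proof. by move=> mG; exact: (mfam_section tt p j a mG). Qed.

(** Integrating against the Dirac mass at 0 writes [(Kz, 0)] into a coordinate that already holds
    it. *)
Lemma iterk_at_zero s (G : state -> \bar R) p : mconst G ->
  (forall j, j \in s -> kappa j = Kz) -> (forall j, j \in s -> p j = (Kz, 0%R)) ->
  iterk mu kappa s G p = G p.
Proof.
move=> mG; elim: s => //= j s IH ks ps.
have kj : kappa j = Kz by rewrite ks ?mem_head.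
rewrite /intk kj /mu /= integral_dirac//; last first.
  by apply: measurable_funTS; exact: (msec p j Kz (iterk_mfam mu kappa s mG)).
rewrite diracE mem_set ?mul1e; last by rewrite /= in_itv/= lexx.
have -> : upds p j (Kz, 0%R) = p.
  by apply/funext => i; rewrite /upds; case: eqVneq => // ->; rewrite ps ?mem_head.
by apply: IH => i is_; [rewrite ks ?inE ?is_ ?orbT|rewrite ps ?inE ?is_ ?orbT].
Qed.

(** Finite outer integrals make the inner ones finite only almost everywhere; the induction
    hypothesis is used at those points, which is enough under the outer integral. *)
Lemma iterkB s (U1 U2 : state -> \bar R) p : mconst U1 -> mconst U2 ->
  (forall q, 0 <= U1 q) -> (forall q, 0 <= U2 q) ->
  iterk mu kappa s U1 p \is a fin_num -> iterk mu kappa s U2 p \is a fin_num ->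
  iterk mu kappa s (fun q => U1 q - U2 q) p =
  iterk mu kappa s U1 p - iterk mu kappa s U2 p.
Proof.
move=> m1 m2 U10 U20; elim: s p => //= j s IH p.
pose D := (`[0%R, +oo[%classic : set mT).
have mD : measurable D by exact: measurable_itv.
have m12 : mconst (fun q => U1 q - U2 q).
  by move=> d' T w k y mw my; apply: emeasurable_funB;
    [exact: (m1 _ _ w)|exact: (m2 _ _ w)].
have ig (U : state -> \bar R) : mconst U -> (forall q, 0 <= U q) ->
    intk mu j (kappa j) (iterk mu kappa s U) p \is a fin_num ->
    (mu j (kappa j)).-integrable D (fun t => iterk mu kappa s U (upds p j (kappa j,
      t))).
  move=> mU U0; rewrite ge0_fin_numE => [fU|]; last first.
    by apply: intk_ge0 => q; exact: iterk_ge0.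
  apply/integrableP; split.
    by apply: measurable_funTS; exact: (msec _ _ _ (iterk_mfam mu kappa s mU)).
  apply: le_lt_trans fU; rewrite le_eqVlt; apply/orP; left; apply/eqP.
  by apply: eq_integral => t _; rewrite gee0_abs//; exact: iterk_ge0.
move=> f1 f2; have i1 := ig _ m1 U10 f1; have i2 := ig _ m2 U20 f2.
rewrite /intk -integralB//; apply: ae_eq_integral => //.
- by apply: measurable_funTS; exact: (msec _ _ _ (iterk_mfam mu kappa s m12)).
- by apply: measurable_int (integrableB mD i1 i2).
have := integrable_ae mD i1; have := integrable_ae mD i2.
by apply: filterS2 => t h1 h2 Dt; apply: IH; [exact: h2|exact: h1].
Qed.

(* The values of [F] on the exceptional null sets are arbitrary: there the partial
   derivatives are junk values, not known to be measurable a priori. *)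
Lemma int_coords_iterk s (F : 'rV[R]_n -> \bar R) (G : state -> \bar R) (x : 'rV[R]_n) :
  mconst G -> (forall j, j \in s -> kappa j = Kd) ->
  (forall y : 'rV[R]_n, (forall i, i \notin s -> y ord0 i = x ord0 i) ->
    (forall i, i \in s -> (0 < y ord0 i)%R /\ ~ S i (y ord0 i)) ->
    F y = G (row_state y)) ->
  int_coords s F x = iterk mu kappa s G (row_state x).
Proof.
move=> mG; elim: s x => [|j s IH] x ks FG /=; first exact: FG.
have kj : kappa j = Kd by rewrite ks ?mem_head.
rewrite /intk kj /mu /=.
(* The point 0 joins the null set: it lies in the domain of integration, but [F] and [G] are
   compared only at positive points. *)
apply: (@integral_off_countable _ _ (S j `|` [set 0%R])) => //.
- rewrite -bigcup2E; apply: bigcup_countable; first exact: countableP.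
  by move=> [|[|i]] _ //=.
- exact: (msec _ _ _ (iterk_mfam mu kappa s mG)).
move=> t /=; rewrite in_itv/= andbT => t0 /not_orP[nS t1].
rewrite IH; first by rewrite row_state_upd kj.
- by move=> i is_; rewrite ks// inE is_ orbT.
move=> y y1 y2; apply: FG => i.
  by rewrite inE negb_or => /andP[ij /y1 ->]; rewrite mxE (negbTE ij).
have [is_ _|nis] := boolP (i \in s); first exact: y2.
rewrite inE (negbTE nis) orbF => /eqP ij; rewrite y1// mxE ij eqxx; split => //.
by rewrite lt_neqAle t0 andbT eq_sym; apply/eqP.
Qed.

Lemma iterk_eq0 s (G : state -> \bar R) p :
  (forall q, (forall i, i \notin s -> q i = p i) -> G q = 0) ->
    iterk mu kappa s G p = 0.
Proof.
move=> G0; rewrite (@eq_iterk _ _ _ _ _ _ (cst 0)); last by move=> q qp _; exact: G0.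
elim: s p {G0} => //= j s IH p; rewrite /intk.
by under eq_integral do rewrite IH; rewrite integral0.
Qed.

Definition coords_above (s : seq 'I_n) (x : 'rV[R]_n) : set 'rV[R]_n :=
  [set y | forall j, (j \in s -> (0 <= y ord0 j)%R) /\ (j \notin s ->
    y ord0 j = x ord0 j)].

(** The sum is fibred over the value of the first coordinate. As [G] vanishes once a point leaves
    its exceptional set, the sum over the half-line reduces to [S j], where it is an integral
    against [muS j]. *)
Lemma esum_coords_iterk s (F : 'rV[R]_n -> \bar R) (G : state -> \bar R) (x :
  'rV[R]_n) :
  uniq s -> mconst G -> (forall q, 0 <= G q) ->
  (forall j, j \in s -> mu j (kappa j) = muS j) ->
  (forall q j, j \in s -> (q j).1 = kappa j -> ~ S j (q j).2 -> G q = 0) ->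
  (forall y, coords_above s x y -> F y = G (row_state y)) ->
  \esum_(y in coords_above s x) F y = iterk mu kappa s G (row_state x).
Proof.
move=> us mG G0; elim: s x us => [|j s IH] x /=.
  move=> _ _ _ FG; have -> : coords_above [::] x = [set x].
    apply/seteqP; split => y /=; last by move=> ->.
    by move=> h; apply/matrixP => i k; rewrite (ord1 i); have [_] := h k; apply.
  by rewrite esum_set1 FG//; move=> i.
move=> /andP[js us] ks GS FG.
have sub t y : (0 <= t)%R -> coords_above s (Defs.upd x j t) y ->
  coords_above (j :: s) x y.
  move=> t0 hy i; have [h1 h2] := hy i; split.
    rewrite inE => /orP[/eqP ij|//]; rewrite ij in h1 h2 *.
    by rewrite (h2 js) mxE eqxx.
  by rewrite inE negb_or => /andP[ij /h2 ->]; rewrite mxE (negbTE ij).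
have FG' t : (0 <= t)%R -> \esum_(y in coords_above s (Defs.upd x j t)) F y =
    iterk mu kappa s G (upds (row_state x) j (kappa j, t)).
  move=> t0; rewrite -row_state_upd; apply: IH => //.
  - by move=> i is_; apply: ks; rewrite inE is_ orbT.
  - by move=> q i is_; apply: GS; rewrite inE is_ orbT.
  - by move=> y hy; apply: FG; exact: sub hy.
transitivity (\esum_(t in `[0%R, +oo[%classic)
    \esum_(y in coords_above s (Defs.upd x j t)) F y).
  rewrite esum_esum; last first.
    by move=> t y /=; rewrite in_itv/= andbT => t0 hy; rewrite FG//; exact: sub hy.
  (* The first component of a pair [(t, y)] is the coordinate [j] of [y], so the second projection
     is a bijection. *)
  apply: (reindex_esum _ _ snd); split.
  - by move=> [t y] /= []; rewrite in_itv/= andbT => t0 hy; exact: sub hy.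
  - move=> [t y] [t' y'] /set_mem[/= _ h] /set_mem[/= _ h'] yy'; congr pair => //.
    have [_ /(_ js)] := h j; have [_ /(_ js)] := h' j.
    by rewrite !mxE eqxx yy' => -> ->.
  - move=> y hy; exists (y ord0 j, y) => //=; split.
      by rewrite in_itv/= andbT; have [h _] := hy j; apply: h; rewrite mem_head.
    move=> i; split => [is_|nis].
      by have [h _] := hy i; apply: h; rewrite inE is_ orbT.
    rewrite mxE; case: (eqVneq i j) => [->//|ij].
    by have [_ h] := hy i; apply: h; rewrite inE negb_or ij.
transitivity (\esum_(t in `[0%R, +oo[%classic)
    iterk mu kappa s G (upds (row_state x) j (kappa j, t))).
  by apply: eq_esum => t /=; rewrite in_itv/= andbT => /FG'.
rewrite /intk ks ?mem_head// muSE//.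
- rewrite esum_mkcondl; apply: eq_esum => t _; case: ifPn => // /negP nS.
  apply: iterk_eq0 => q /(_ _ js); rewrite /upds eqxx => qj.
  by apply: (GS q j); rewrite ?mem_head// qj//= => /mem_set.
- by apply: measurable_funTS; exact: (msec _ _ _ (iterk_mfam mu kappa s mG)).
- by move=> t _; exact: iterk_ge0.
Qed.

End Rows.

(** * Mixed operators acting on sums of products *)

Section MixedOperators.
Context {R : realType} {n : nat} {I : finType}.
Variables (S : 'I_n -> set R) (f : I -> 'I_n -> R -> R).
Hypothesis S_ge0 : forall j, S j `<=` [set x | 0 <= x].
Hypothesis f_regular : forall k j, regular_off (S j) (f k j).
Implicit Types (ko : 'I_n -> option kind) (g : 'rV[R]_n -> R) (y : 'rV[R]_n).

(* [ko j = None] means that no operator has been applied yet in the variable [j]. *)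
Definition good_points ko j : set R :=
  if ko j is Some Kd then [set t | 0 < t /\ ~ S j t] else [set t | 0 <= t].

Definition partial_factor ko k j t : R :=
  if ko j is Some a then part (S j) (f k j) a t else f k j t.

Definition represents ko g : Prop := forall y,
  (forall j, good_points ko j (y ord0 j)) ->
  g y = \sum_k \prod_j partial_factor ko k j (y ord0 j).

Definition assign ko (s : seq 'I_n) a : 'I_n -> option kind :=
  fun i => if i \in s then Some a else ko i.

Definition op_of_kind a : 'I_n -> ('rV[R]_n -> R) -> 'rV[R]_n -> R :=
  match a with Kz => at_zero | Kd => partial | Kr => jump_r | Kl => jump_l end.

Lemma upd_id y j : Defs.upd y j (y ord0 j) = y.
Proof.
by apply/matrixP => i k; rewrite mxE (ord1 i); case: eqVneq => [->|].
Qed.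

Lemma partial_upd g y j :
  partial j g y = (fun t => g (Defs.upd y j t))^`()%classic (y ord0 j).
Proof.
rewrite derive1E /partial /derive; congr (lim (_ @ 0^')).
apply/funext => e; congr (_ *: (g _ - g _)); last by rewrite upd_id.
apply/matrixP => i k; rewrite !mxE (ord1 i) eqxx /=.
case: eqVneq => [->//|_].
by rewrite mulr0 add0r.
Qed.

(** With the other coordinates frozen, [g] is a linear combination [F] of the [f k j], and [part] is
    linear. The two agree only for [t >= 0], which is enough: derivatives and left jumps are taken
    at positive points, and right limits only look to the right. *)
Lemma represents_op ko j a g : ko j = None -> represents ko g ->
  represents (assign ko [:: j] a) (op_of_kind a j g).
Proof.
move=> koj rg y hy.
pose c k := \prod_(i | i != j) partial_factor ko k i (y ord0 i).
pose F t := \sum_k c k * f k j t.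
pose L t := g (Defs.upd y j t).
have yj0 : 0 <= y ord0 j.
  by have := hy j; rewrite /good_points /assign mem_head; case: (a) => //= -[/ltW].
have LF t : 0 <= t -> L t = F t.
  move=> t0; rewrite /L rg => [|i]; last first.
    rewrite mxE; case: (eqVneq i j) => [->|ij]; first by rewrite /good_points koj.
    by have := hy i; rewrite /good_points /assign inE (negbTE ij).
  apply: eq_bigr => k _; rewrite (bigD1 j)//= mxE eqxx /partial_factor koj mulrC.
  by congr (_ * _); apply: eq_bigr => i ij; rewrite mxE (negbTE ij).
have [rF pF] := regular_off_sum (index_enum I) c (@S_ge0 j) (fun k => f_regular k j).
have -> : \sum_k \prod_i partial_factor (assign ko [:: j] a) k i (y ord0 i) =
    part (S j) F a (y ord0 j).
  rewrite pF; apply: eq_bigr => k _; rewrite (bigD1 j)//= /partial_factor.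
  rewrite {1}/assign mem_head mulrC; congr (_ * _).
  by apply: eq_bigr => i ij; rewrite /assign inE (negbTE ij).
have {}rF : regular_off (S j) F by exact: rF.
have gy : g y = F (y ord0 j) by rewrite -LF// /L upd_id.
case: a hy => hy; rewrite /op_of_kind.
- by rewrite /at_zero -/(L 0) LF.
- rewrite partial_upd -/L /part.
  have [y0 nSy] : 0 < y ord0 j /\ ~ S j (y ord0 j).
    by have := hy j; rewrite /good_points /assign mem_head.
  rewrite memNset//= leNgt y0 /=; rewrite !derive1E.
  apply: near_eq_derive.
  by near=> t; apply: LF; apply: ltW; near: t; exact: lt_nbhsr.
- rewrite (part_rE rF yj0) /jump_r -/L gy; congr (_ - _).
  congr (lim (_ : set_system R)); apply/seteqP; split; apply: near_eq_cvg; near=> t.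
    by apply: LF; apply: (le_trans yj0); apply: ltW; near: t; exact: nbhs_right_gt.
  by apply/esym/LF; apply: (le_trans yj0); apply: ltW; near: t; exact: nbhs_right_gt.
- rewrite /jump_l; case: eqVneq => [->|y0].
    by rewrite /part ltxx andbF.
  have {}y0 : 0 < y ord0 j by rewrite lt_neqAle eq_sym y0.
  rewrite (part_lE rF y0) -/L gy; congr (_ - _).
  congr (lim (_ : set_system R)); apply/seteqP; split; apply: near_eq_cvg; near=> t.
    by apply: LF; apply: ltW; near: t; exact: nbhs_left_gt.
  by apply/esym/LF; apply: ltW; near: t; exact: nbhs_left_gt.
Unshelve. all: by end_near. Qed.

Lemma represents_foldr ko s a g : uniq s -> (forall j, j \in s -> ko j = None) ->
  represents ko g -> represents (assign ko s a) (foldr (op_of_kind a) g s).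
Proof.
move=> us + rg; elim: s us => [_ _|j s IH /= /andP[js us] ks].
  by move: rg; congr represents; apply/funext => i.
have -> : assign ko (j :: s) a = assign (assign ko s a) [:: j] a.
  by apply/funext => i; rewrite /assign !inE; case: eqVneq.
apply: represents_op; first by rewrite /assign (negbTE js) ks// mem_head.
by apply: IH => // i is_; rewrite ks// inE is_ orbT.
Qed.

Variable h : 'rV[R]_n -> R.
Hypothesis hE : forall x : 'rV[R]_n, (forall j, 0 <= x ord0 j) ->
  h x = \sum_k \prod_j f k j (x ord0 j).

(** The blocks act in the order d, z, l, r from the inside out. A coordinate has a single kind, so
    each block meets only coordinates on which nothing has acted yet. *)
Lemma mixed_op_represents (kappa : 'I_n -> kind) :
  represents (Some \o kappa)
    (mixed_op [set j | kappa j == Kz]%SET [set j | kappa j == Kd]%SET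
              [set j | kappa j == Kr]%SET [set j | kappa j == Kl]%SET h).
Proof.
pose e a := enum [set j | kappa j == a]%SET.
have r0 : represents (fun _ => None) h by move=> y hy; apply: hE.
have ue a : uniq (e a) by exact: enum_uniq.
have me j a : (j \in e a) = (kappa j == a) by rewrite mem_enum inE.
have r1 := @represents_foldr _ (e Kd) Kd _ (ue _) (fun _ _ => erefl) r0.
have n2 j : j \in e Kz -> assign (fun _ => None) (e Kd) Kd j = None.
  by rewrite /assign !me => /eqP ->.
have r2 := @represents_foldr _ (e Kz) Kz _ (ue _) n2 r1.
have n3 j : j \in e Kl -> assign (assign (fun _ => None) (e Kd) Kd) (e Kz) Kz j = None.
  by rewrite /assign !me => /eqP ->.
have r3 := @represents_foldr _ (e Kl) Kl _ (ue _) n3 r2.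
have n4 j : j \in e Kr ->
    assign (assign (assign (fun _ => None) (e Kd) Kd) (e Kz) Kz) (e Kl) Kl j = None.
  by rewrite /assign !me => /eqP ->.
have r4 := @represents_foldr _ (e Kr) Kr _ (ue _) n4 r3.
move: r4; congr represents; apply/funext => j; rewrite /assign !me /=.
by case: (kappa j).
Qed.

End MixedOperators.

(** * The functionals as iterated integrals over kinds *)

Section Functionals.
Local Open Scope ereal_scope.
Context d {Om : measurableType d} {R : realType} {n : nat} {I : finType}.
Local Notation mT := (measurableTypeR R).
Local Notation state := ('I_n -> kind * R).
Variables (S : 'I_n -> set R) (f : I -> 'I_n -> R -> R).
Variable muS : 'I_n -> {sigma_finite_measure set mT -> \bar R}.
Variable X : 'I_n -> Om -> R.
Hypothesis S_ge0 : forall j, S j `<=` [set x | (0 <= x)%R].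
Hypothesis S_countable : forall j, countable (S j).
Hypothesis f_regular : forall k j, regular_off (S j) (f k j).
Hypothesis muSE : forall j (D : set mT) (F : R -> \bar R),
  measurable D -> measurable_fun D F -> (forall x, D x -> 0 <= F x) ->
  \int[muS j]_(t in D) F t = \esum_(t in S j `&` D) F t.
Hypothesis mX : forall j, measurable_fun setT (X j).
Variable Q : probability Om R.
Variable h : 'rV[R]_n -> R.
Hypothesis hE : forall x : 'rV[R]_n, (forall j, (0 <= x ord0 j)%R) ->
  h x = (\sum_k \prod_j f k j (x ord0 j))%R.

Let mu j a := kind_measure (muS j) a.

Definition mean_term (g : R -> R) (q : state) : \bar R :=
  \int[Q]_w (g (term S f X w q))%:E.

Definition kind_functional (g : R -> R) (kappa : {ffun 'I_n -> kind}) : \bar R :=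
  iterk mu kappa (enum 'I_n) (mean_term g) (fun _ => (Kz, 0%R)).

Lemma measurable_all_reachable q :
  measurable [set w | [forall j, reachable X w q j]].
Proof.
pose r (w : Om) : R := (\prod_j (reachable X w q j)%:R)%R.
have mr : measurable_fun setT r.
  apply: measurable_prod => j _.
  by apply: measurable_reach; [exact: measurable_cst|exact: mX].
have -> : [set w | [forall j, reachable X w q j]] = setT `&` r @^-1` [set 1%R].
  rewrite setTI; apply/seteqP; split => w /=.
    by move=> /forallP hr; rewrite /r big1// => j _; rewrite hr.
  move=> rw; apply/forallP => j; apply: contraT => nj; move: rw.
  by rewrite /r (bigD1 j)//= (negbTE nj) mul0r => /esym/eqP; rewrite oner_eq0.
exact: mr.
Qed.

(** As [g] vanishes at 0, the indicator of the box comes out of [g], and its mean is the tail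
    probability. *)
Lemma mean_termE g q : g 0%R = 0%R ->
  mean_term g q = (g (weight S f q))%:E * Q [set w | [forall j, reachable X w q j]].
Proof.
move=> g0; rewrite /mean_term.
have mB := measurable_all_reachable q.
transitivity (\int[Q]_w (g (weight S f q) * ([forall j, reachable X w q j])%:R)%:E).
  apply: eq_integral => w _; rewrite termE.
  by case: [forall j, _]; rewrite ?mulr1 ?mulr0 ?g0.
rewrite (@integral_mul_bool _ _ _ Q setT [set w | [forall j, reachable X w q j]]) //.
  by rewrite integral_cst.
by move=> w _; rewrite mem_setE.
Qed.

Lemma mean_term_mfam (g : R -> R) : measurable_fun setT g -> mfam (fun _ :
  unit => mean_term g).
Proof.
move=> mg d' T w kappa y mw my.
have := mfam_integral Q (term_mfam S_countable f_regular mX mg).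
by move=> /(_ _ T (fun _ => point) kappa y (measurable_cst _) my).
Qed.

Section FixedKinds.
Variable kappa : {ffun 'I_n -> kind}.

Let z : {set 'I_n} := [set j | kappa j == Kz]%SET.
Let dd : {set 'I_n} := [set j | kappa j == Kd]%SET.
Let r : {set 'I_n} := [set j | kappa j == Kr]%SET.
Let l : {set 'I_n} := [set j | kappa j == Kl]%SET.

Let st := row_state (R := R) kappa.

Lemma tail_probE y :
  tail_prob Q X dd r l y = Q [set w | [forall j, reachable X w (st y) j]].
Proof.
congr (Q _); apply/seteqP; split => w /=.
  move=> [h1 h2]; apply/forallP => j; rewrite /reachable /st /row_state /=.
  case E : (kappa j) => //=.
  - by apply: h1; rewrite !inE E.
  - by apply: h1; rewrite !inE E.
  - by apply: h2; rewrite inE E.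
move=> /forallP hr; split => j.
  rewrite !inE => /orP[] /eqP E; have := hr j;
  by rewrite /reachable /st /row_state /= E.
by rewrite inE => /eqP E; have := hr j; rewrite /reachable /st /row_state /= E.
Qed.

Lemma mean_term_off g q j : g 0%R = 0%R -> j \in r :|: l -> (q j).1 = kappa j ->
  ~ S j (q j).2 -> mean_term g q = 0.
Proof.
move=> g0 jrl qj nS; rewrite mean_termE// (_ : weight S f q = 0%R) ?g0 ?mul0e//.
rewrite /weight big1// => k _; rewrite (bigD1 j)//= /factor.
move: jrl; rewrite !inE qj => /orP[] /eqP ->; by rewrite /part memNset ?mul0r.
Qed.

Let U g := iterk mu kappa (enum (r :|: l)) (mean_term g).

(** Reordering puts d outermost, then r and l, then z. The innermost block integrates against Dirac
    masses at 0 from a state already equal to 0 there, so it disappears. *)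
Lemma kind_functionalE (g : R -> R) : measurable_fun setT g -> (forall x, 0 <= g x)%R ->
  kind_functional g kappa = iterk mu kappa (enum dd) (U g) (st 0%R).
Proof.
move=> mg g0; rewrite /kind_functional.
have M0 q : 0 <= mean_term g q by apply: integral_ge0 => w _; rewrite lee_fin.
have mM := mean_term_mfam mg.
transitivity (iterk mu kappa (enum 'I_n) (mean_term g) (st 0%R)).
  by apply: iterk_agree => i; rewrite mem_enum.
have pe : perm_eq (enum 'I_n) (enum dd ++ enum (r :|: l) ++ enum z).
  apply: uniq_perm; first exact: enum_uniq.
    rewrite !cat_uniq !enum_uniq /= andbT; apply/andP; split.
      apply/hasPn => j; rewrite mem_cat !mem_enum !inE.
      by case: (kappa j).
    by apply/hasPn => j; rewrite !mem_enum !inE; case: (kappa j).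
  by move=> j; rewrite !mem_cat !mem_enum !inE; case: (kappa j).
rewrite (iterk_perm mu kappa tt (enum_uniq _) pe mM (fun _ => M0)).
have iterk_cat s1 s2 F :
    iterk mu kappa (s1 ++ s2) F = iterk mu kappa s1 (iterk mu kappa s2 F).
  exact: foldr_cat.
rewrite !iterk_cat.
apply: eq_iterk => q q1 _; apply: eq_iterk => q' q1' _.
apply: (iterk_at_zero muS mM) => j; rewrite mem_enum inE => /eqP kj //.
rewrite q1' ?q1 ?mem_enum ?inE ?kj//.
by rewrite /st /row_state kj mxE.
Qed.

(** [sum_coords] separates positive and negative parts inside the Lebesgue integrals. [g1] and [g2]
    express these parts through [weight]: the two parts of the identity for [A_fun], the absolute
    value and 0 for [absA_fun]. *)
Lemma A_genE (gm : 'rV[R]_n -> R) (g1 g2 : R -> R) :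
  measurable_fun setT g1 -> (forall x, 0 <= g1 x)%R -> g1 0%R = 0%R ->
  measurable_fun setT g2 -> (forall x, 0 <= g2 x)%R -> g2 0%R = 0%R ->
  (forall y : 'rV[R]_n, (forall j, good_points S (Some \o kappa) j (y ord0 j)) ->
    Num.max (gm y) 0%R = g1 (weight S f (st y)) /\
    Num.max (- gm y)%R 0%R = g2 (weight S f (st y))) ->
  A_gen Q X dd r l gm =
  iterk mu kappa (enum dd) (fun q => U g1 q - U g2 q) (st 0%R).
Proof.
move=> m1 p1 z1 m2 p2 z2 gmE.
have M0 (g : R -> R) q : (forall x, 0 <= g x)%R -> 0 <= mean_term g q.
  by move=> g0; apply: integral_ge0 => w _; rewrite lee_fin.
have mU (g : R -> R) : measurable_fun setT g -> mfam (fun _ : unit => U g).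
  by move=> mg; apply: iterk_mfam; exact: mean_term_mfam.
rewrite /A_gen; apply: (int_coords_iterk muS S_countable).
- move=> d' T w k y mw my; apply: emeasurable_funB.
    exact: (mU _ m1 _ _ w).
  exact: (mU _ m2 _ _ w).
- by move=> j; rewrite mem_enum inE => /eqP.
move=> x x1 x2.
have Yx : [set y : 'rV[R]_n | forall j, (j \in r :|: l -> (0 <= y ord0 j)%R) /\
    (j \notin r :|: l -> y ord0 j = x ord0 j)] = coords_above (enum (r :|: l)) x.
  by apply/seteqP; split => y hy j; have := hy j; rewrite mem_enum.
have goody (y : 'rV[R]_n) : coords_above (enum (r :|: l)) x y ->
    forall j, good_points S (Some \o kappa) j (y ord0 j).
  move=> hy j; rewrite /good_points /=; have [] := hy j; rewrite mem_enum !inE.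
  case E : (kappa j) => /= h1 h2.
  - by rewrite h2// x1 ?mxE// mem_enum inE E.
  - by rewrite h2//; apply: x2; rewrite mem_enum inE E.
  - exact: h1.
  - exact: h1.
rewrite /sum_coords Yx.
(* Tail probabilities are finite and non-negative, so they factor out of positive and negative
   parts. *)
have tfin y : tail_prob Q X dd r l y = (fine (tail_prob Q X dd r l y))%:E.
  by rewrite fineK// tail_probE fin_num_measure//; exact: measurable_all_reachable.
have t0 y : (0 <= fine (tail_prob Q X dd r l y))%R by exact: fine_ge0.
congr (_ - _); apply: (esum_coords_iterk muSE).
- exact: enum_uniq.
- exact: mean_term_mfam.
- by move=> q; exact: M0.
- by move=> j; rewrite mem_enum !inE => /orP[] /eqP ->.
- by move=> q j; rewrite mem_enum; exact: mean_term_off.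
- move=> y hy; have [g1E _] := gmE y (goody y hy).
  rewrite mean_termE// -tail_probE -g1E funeposE tfin -!EFinM -EFin_max; congr EFin.
  by rewrite maxr_pMl// mul0r.
- exact: enum_uniq.
- exact: mean_term_mfam.
- by move=> q; exact: M0.
- by move=> j; rewrite mem_enum !inE => /orP[] /eqP ->.
- by move=> q j; rewrite mem_enum; exact: mean_term_off.
- move=> y hy; have [_ g2E] := gmE y (goody y hy).
  rewrite mean_termE// -tail_probE -g2E funenegE tfin -!EFinM -EFinN -EFin_max;
    congr EFin.
  by rewrite -mulNr maxr_pMl// mul0r.
Qed.

Lemma mixed_op_weight (y : 'rV[R]_n) :
  (forall j, good_points S (Some \o kappa) j (y ord0 j)) ->
  mixed_op z dd r l h y = weight S f (st y).
Proof. exact: (mixed_op_represents S_ge0 f_regular hE). Qed.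

Lemma absA_funE : absA_fun Q X z dd r l h = kind_functional Num.norm kappa.
Proof.
have mn : measurable_fun setT (Num.norm : R -> R) by exact: normr_measurable.
rewrite kind_functionalE// /absA_fun (@A_genE _ Num.norm (cst 0%R))//.
- apply: eq_iterk => q _ _.
  rewrite [X in _ - X](_ : _ = 0) ?sube0//; apply: iterk_eq0 => q' _.
  by rewrite mean_termE// mul0e.
- exact: normr0.
- move=> y /mixed_op_weight ->; split; first by apply/max_idPl.
  by apply/max_idPr; rewrite oppr_le0.
Qed.

(** In [A_fun] the subtraction happens under the Lebesgue integrals; finiteness of both parts allows
    [iterkB] to move it outside. *)
Lemma A_funE : kind_functional (fun x => Num.max x 0)%R kappa \is a fin_num ->
  kind_functional (fun x => Num.max (- x) 0)%R kappa \is a fin_num ->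
  A_fun Q X z dd r l h = kind_functional (fun x => Num.max x 0)%R kappa -
    kind_functional (fun x => Num.max (- x) 0)%R kappa.
Proof.
have mp : measurable_fun setT (fun x : R => Num.max x 0%R).
  by apply: measurable_maxr => //; exact: measurable_cst.
have mn : measurable_fun setT (fun x : R => Num.max (- x)%R 0%R).
  by apply: measurable_maxr; [exact: measurable_funN|exact: measurable_cst].
have p0 (x : R) : (0 <= Num.max x 0)%R by rewrite le_max lexx orbT.
have mU (g : R -> R) : measurable_fun setT g -> mfam (fun _ : unit => U g).
  by move=> mg; apply: iterk_mfam; exact: mean_term_mfam.
have U0 (g : R -> R) q : (forall x, 0 <= g x)%R -> 0 <= U g q.
  move=> g0; apply: iterk_ge0 => q'; apply: integral_ge0 => w _.
  by rewrite lee_fin.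
rewrite !kind_functionalE// => f1 f2.
rewrite /A_fun (A_genE mp (fun x => p0 x) _ mn (fun x => p0 (- x)%R)).
- by apply: iterkB => //; [exact: mU|exact: mU|move=> q; exact: U0|move=> q; exact: U0].
- by rewrite maxxx.
- by rewrite oppr0 maxxx.
- by move=> y /mixed_op_weight ->.
Qed.

End FixedKinds.
End Functionals.

(** * Splits of the coordinates as assignments of kinds *)

Section Splits.
Context {n : nat}.
Implicit Types (z d r l : {set 'I_n}) (kappa : {ffun 'I_n -> kind}).

Definition kind_set kappa a : {set 'I_n} := [set j | kappa j == a]%SET.

Definition split_of kappa := (kind_set kappa Kz,
  (kind_set kappa Kd, (kind_set kappa Kr, kind_set kappa Kl))).

Definition kinds_of (s : {set 'I_n} * ({set 'I_n} * ({set 'I_n} * {set 'I_n}))) :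
    {ffun 'I_n -> kind} :=
  [ffun j => if j \in s.1 then Kz else if j \in s.2.1 then Kd
             else if j \in s.2.2.1 then Kr else Kl].

Lemma split_ofK : cancel split_of kinds_of.
Proof.
by move=> kappa; apply/ffunP => j; rewrite ffunE /= !inE; case: (kappa j).
Qed.

(** Multiplicities at most 1 with sum [n] are all 1, by the equality case of a sum of inequalities.
    Conversely [0 < n] is what makes the maximum 1, as an empty maximum is 0. *)
Lemma is_splitE z d r l : (0 < n)%N ->
  is_split z d r l = [forall k, multiplicity z d r l k == 1%N].
Proof.
move=> n0; apply/andP/forallP => [[/eqP sn /eqP m1] k|all1].
  have le1 i : (multiplicity z d r l i <= 1)%N.
    by rewrite -[X in (_ <= X)%N]m1; exact: (leq_bigmax (F := multiplicity z d r l)).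
  have := leqif_sum (fun i (_ : true) => leqif_eq (le1 i)).
  move=> [_]; rewrite sn sum1_card card_ord eqxx => /esym/forallP/(_ k).
  by rewrite implyTb.
split.
  by under eq_bigr do rewrite (eqP (all1 _)); rewrite sum1_card card_ord.
rewrite eqn_leq; apply/andP; split; first by apply/bigmax_leqP => i _;
  rewrite (eqP (all1 i)).
by rewrite -(eqP (all1 (Ordinal n0))); exact: (leq_bigmax (F := multiplicity z d r l)).
Qed.

Lemma is_split_split_of kappa : (0 < n)%N ->
  is_split (kind_set kappa Kz) (kind_set kappa Kd)
    (kind_set kappa Kr) (kind_set kappa Kl).
Proof.
move=> n0; rewrite is_splitE//; apply/forallP => j.
by rewrite /multiplicity !inE; case: (kappa j).
Qed.

Lemma kinds_ofK s : (0 < n)%N -> is_split s.1 s.2.1 s.2.2.1 s.2.2.2 ->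
  split_of (kinds_of s) = s.
Proof.
case: s => z [d [r l]] n0 /=; rewrite is_splitE// => /forallP h.
congr (_, (_, (_, _))); apply/setP => j; rewrite inE ffunE /=; have := h j;
by rewrite /multiplicity; do 4!case: (_ \in _).
Qed.

Lemma sum_is_split (R : realType) (F : {set 'I_n} -> {set 'I_n} -> {set 'I_n} ->
    {set 'I_n} -> \bar R) : (0 < n)%N ->
  (\sum_z \sum_d \sum_r \sum_(l | is_split z d r l) F z d r l =
   \sum_kappa F (kind_set kappa Kz) (kind_set kappa Kd)
     (kind_set kappa Kr) (kind_set kappa Kl))%E.
Proof.
move=> n0.
transitivity (\sum_(s | is_split s.1 s.2.1 s.2.2.1 s.2.2.2)
    F s.1 s.2.1 s.2.2.1 s.2.2.2)%E.
  under eq_bigr do under eq_bigr do rewrite pair_big_dep.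
  under eq_bigr do rewrite pair_big_dep.
  by rewrite pair_big_dep.
rewrite (reindex_onto split_of kinds_of) => [|s ss]; last exact: kinds_ofK.
by apply: eq_bigl => kappa; rewrite split_ofK eqxx andbT; exact: is_split_split_of.
Qed.

End Splits.

Theorem theorem3p1 (d : measure_display) (Omega : measurableType d)
    (R : realType) (Q : probability Omega R) (n : nat) (hn : (0 < n)%N)
    (T : R) (hT : 0 < T)
    (B : R -> R) (hB0 : B 0 = 1)
    (hB : {in `[0, T] &, {homo B : s t / s <= t}})
    (X : 'I_n -> {RV Q >-> R})
    (hXint : forall k, Q.-integrable setT (EFin \o X k))
    (hXpos : forall k, {ae Q, forall w, 0 <= X k w})
    (h : 'rV[R]_n -> R)
    (hh : PiN_class Q X h)
    (hA : forall z dd r l : {set 'I_n}, is_split z dd r l ->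
       (absA_fun Q X z dd r l h < +oo)%E) :
  price Q (B T) X h =
  (((B T)^-1)%:E *
   \sum_(z : {set 'I_n}) \sum_(dd : {set 'I_n}) \sum_(r : {set 'I_n})
     \sum_(l : {set 'I_n} | is_split z dd r l) A_fun Q X z dd r l h)%E.
Proof.
have [m [f [hE fPi fint _]]] := hh.
have /choice[S hS] j : exists S : set R, [/\ S `<=` [set x | 0 <= x], countable S,
    forall A, A `<=` S -> A !=set0 -> exists2 m, A m & forall y, A y -> m <= y &
    forall k, regular_off S (f k j)].
  by apply: exists_common_exceptional_set => k; have [] := fPi k j.
have S0 j : S j `<=` [set x | 0 <= x] by have [] := hS j.
have Sc j : countable (S j) by have [] := hS j.
have Sm j A : A `<=` S j -> A !=set0 -> exists2 m, A m & forall y, A y -> m <= y.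
  by have [_ _ hm _] := hS j; exact: hm.
have fr k j : regular_off (S j) (f k j) by have [] := hS j.
have /choice[muS muSE] j := exists_counting_measure (Sc j).
have mX j : measurable_fun setT (X j : Omega -> R) by [].
have absE := absA_funE S0 Sc fr muSE mX Q hE.
have AE := A_funE S0 Sc fr muSE mX hE.
pose H := (fun w => h (vec X w)) \_ (nonneg_event X).
have mN : measurable (nonneg_event X).
  have -> : nonneg_event X = \bigcap_(k in [set: 'I_n]) [set w | 0 <= X k w].
    by apply/seteqP; split => [w hw k _|w hw k]; exact: hw.
  apply: fin_bigcap_measurable => // k _.
  have -> : [set w | 0 <= X k w] = setT `&` (X k) @^-1` `[0, +oo[%classic.
    by rewrite setTI; apply/seteqP; split => w /=; rewrite in_itv/= andbT.
  exact: mX.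
have Hnn w : nonneg_event X w -> H w = \sum_k \prod_j f k j (X j w).
  move=> Nw; rewrite /H patchE mem_set// hE => [|j]; last by rewrite mxE.
  by apply: eq_bigr => k _; apply: eq_bigr => j _; rewrite mxE.
have mH : measurable_fun setT H.
  apply/(measurable_restrict _ mN measurableT); rewrite setTI.
  apply: (eq_measurable_fun (fun w => \sum_k \prod_j f k j (X j w))).
    by move=> w /set_mem Nw; rewrite -Hnn// /H patchE mem_set.
  apply: measurable_sum => k.
  (* For the last index and the identity permutation, the partial product in the integrability
     clause is the full product over the coordinates, which is therefore measurable. *)
  have n1 : (n.-1 < n)%N by rewrite prednK.
  have /measurable_int := fint k (Ordinal n1) 1%g.
  move=> /measurable_EFinP; congr measurable_fun; apply/funext => w.
  apply: eq_big => [j|j _]; last by rewrite perm1.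
  by rewrite -ltnS /= prednK// ltn_ord.
have aeN : {ae Q, forall w, forall j, 0 <= X j w}.
  exact: filter_forall.
have aeH : {ae Q, forall w, H w = \sum_k \prod_j f k j (X j w)}.
  by apply: filterS aeN => w; exact: Hnn.
have absfin kappa : (kind_functional S f muS X Q Num.norm kappa < +oo)%E.
  by rewrite -absE; apply: hA; exact: is_split_split_of.
have [EH Afin] := expectation_expansion S0 Sc Sm fr muSE mX mH aeN aeH absfin.
rewrite /price unlock; congr (_ * _)%E; rewrite -/H.
rewrite [LHS]EH sum_is_split//; apply: eq_bigr => kappa _.
by have [fp fn] := Afin kappa; rewrite AE.
Qed.
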